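(* Let $A$ be a dg algebra over $k$ and let $S\subset H(A)$ be an arbitrary set of homogeneous homology classes. Choose a cycle representing each class in $S$, giving a dg algebra map $k\langle S\rangle\to A$. Then the derived localisation of $A$ at $S$ is given by $$L_S(A)\simeq A\ast^{\mathbb{L}}_{k\langle S\rangle}k\langle S,S^{-1}\rangle .$$
   Context: $k$ is a fixed unital commutative ring. A dg algebra is a unital associative differential $\mathbb{Z}$-graded (homologically graded) $k$-algebra; the category of dg algebras carries the model structure with weak equivalences the quasi-isomorphisms and fibrations the surjections. For a dg algebra $A$ with cofibrant replacement $Q\to A$, the derived under category of $A$ is the homotopy category of the under category $Q\downarrow \mathrm{dgAlg}$ (independent of $Q$ up to natural equivalence). An object $Q\to Y$ is $S$-inverting if for each $s\in S\subset H(A)\cong H(Q)$ the image of $s$ in $H(Y)$ is invertible. The derived localisation $L_S(A)$ is the initial object of the full subcategory of $S$-inverting objects of the derived under category of $A$. $k\langle S\rangle$ is the free graded algebra on $S$ (with $s$ in the same degree as in $H(A)$) with zero differential; $k\langle S,S^{-1}\rangle$ is the graded algebra, with zero differential, generated by symbols $s,s^{-1}$ ($s\in S$, $|s^{-1}|=-|s|$) with relations $ss^{-1}=s^{-1}s=1$. The derived free product $B\ast_A^{\mathbb{L}}C$ is the homotopy pushout of dg algebras: with $k\rightarrowtail Q\to A$ and $Q\rightarrowtail P\to B$ cofibrant replacements, $C\mapsto B\ast^{\mathbb{L}}_A C$ is the total left derived functor of $C\mapsto P\ast_Q C$ (pushout of dg algebras) from the derived under category of $A$ to that of $B$. *)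

(* Defs.v *)
From HB Require Import structures.
From mathcomp Require Import all_boot all_order all_algebra.
From mathcomp Require Import generic_quotient ring_quotient.
From mathcomp Require Import boolp classical_sets.

Set Implicit Arguments.
Unset Strict Implicit.
Unset Printing Implicit Defensive.

Import GRing.Theory.

Local Open Scope ring_scope.
Local Open Scope quotient_scope.

Record category := Category {
  ob :> Type;
  hom : ob -> ob -> Type;
  idc : forall x, hom x x;
  ccomp : forall x y z, hom y z -> hom x y -> hom x z;
  ccompA : forall x y z t (h : hom z t) (g : hom y z) (f : hom x y),
    ccomp h (ccomp g f) = ccomp (ccomp h g) f;
  ccomp1f : forall x y (f : hom x y), ccomp (idc y) f = f;
  ccompf1 : forall x y (f : hom x y), ccomp f (idc x) = f }.

Arguments hom {c} x y.
Arguments idc {c} x.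
Arguments ccomp {c x y z} g f.

Declare Scope cat_scope.
Delimit Scope cat_scope with cat.
Notation "g '\oc' f" := (ccomp g f) (at level 40, left associativity) : cat_scope.
Local Open Scope cat_scope.

Definition hom_class (C : category) := forall x y : C, hom x y -> Prop.

(** An object [x] satisfying [P] that is initial in the full subcategory of
    the objects satisfying [P]. *)
Definition initial_among (C : category) (P : C -> Prop) (x : C) : Prop :=
  P x /\ forall y : C, P y -> exists! f : hom x y, True.

Definition is_pushout (C : category) (a b c x : C)
    (f : hom a b) (g : hom a c) (f' : hom b x) (g' : hom c x) : Prop :=
  f' \oc f = g' \oc g /\
  forall (y : C) (u : hom b y) (v : hom c y), u \oc f = v \oc g ->
    exists! w : hom x y, w \oc f' = u /\ w \oc g' = v.

Definition left_lifting (C : category) (a b x y : C)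
    (i : hom a b) (p : hom x y) : Prop :=
  forall (u : hom a x) (v : hom b y), p \oc u = v \oc i ->
    exists h : hom b x, h \oc i = u /\ p \oc h = v.

Section Under.
Variables (C : category) (q : C).

Record under_ob := UnderOb { under_tgt : C; under_map : hom q under_tgt }.

Definition under_hom (x y : under_ob) :=
  {f : hom (under_tgt x) (under_tgt y) | f \oc under_map x = under_map y}.

Lemma under_hom_eq (x y : under_ob) (f g : under_hom x y) :
  sval f = sval g -> f = g.
Proof. by case: f g => [f ef] [g eg] /= fg; exact: eq_exist. Qed.

Definition under_id (x : under_ob) : under_hom x x :=
  exist _ (idc (under_tgt x)) (ccomp1f (under_map x)).

Lemma under_comp_subproof (x y z : under_ob)
    (g : under_hom y z) (f : under_hom x y) :
  (sval g \oc sval f) \oc under_map x = under_map z.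
Proof. by case: g f => [g eg] [f ef] /=; rewrite -ccompA ef eg. Qed.

Definition under_comp (x y z : under_ob)
    (g : under_hom y z) (f : under_hom x y) : under_hom x z :=
  exist _ (sval g \oc sval f) (under_comp_subproof g f).

Definition under : category.
Proof.
refine (@Category under_ob under_hom under_id under_comp _ _ _).
- by move=> *; apply: under_hom_eq; exact: ccompA.
- by move=> *; apply: under_hom_eq; exact: ccomp1f.
- by move=> *; apply: under_hom_eq; exact: ccompf1.
Defined.

Definition under_class (W : hom_class C) : hom_class under :=
  fun x y f => W _ _ (sval f).

End Under.

Section Localisation.
Variables (C : category) (W : hom_class C).

Inductive zigzag : C -> C -> Type :=
| zz_nil x : zigzag x x
| zz_fwd x y z : hom x y -> zigzag y z -> zigzag x z
| zz_bwd x y z (w : hom y x) : W w -> zigzag y z -> zigzag x z.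

Inductive zz_eq : forall x y : C, zigzag x y -> zigzag x y -> Prop :=
| zz_refl x y (p : zigzag x y) : zz_eq p p
| zz_sym x y (p p' : zigzag x y) : zz_eq p p' -> zz_eq p' p
| zz_trans x y (p p' p'' : zigzag x y) :
    zz_eq p p' -> zz_eq p' p'' -> zz_eq p p''
| zz_congr_fwd x y z (f : hom x y) (p p' : zigzag y z) :
    zz_eq p p' -> zz_eq (zz_fwd f p) (zz_fwd f p')
| zz_congr_bwd x y z (w : hom y x) (Ww : W w) (p p' : zigzag y z) :
    zz_eq p p' -> zz_eq (zz_bwd Ww p) (zz_bwd Ww p')
| zz_id x y (p : zigzag x y) : zz_eq (zz_fwd (idc x) p) p
| zz_comp x y z t (f : hom x y) (g : hom y z) (p : zigzag z t) :
    zz_eq (zz_fwd f (zz_fwd g p)) (zz_fwd (g \oc f) p)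
| zz_fwd_bwd x y z (w : hom x y) (Ww : W w) (p : zigzag x z) :
    zz_eq (zz_fwd w (zz_bwd Ww p)) p
| zz_bwd_fwd x y z (w : hom y x) (Ww : W w) (p : zigzag x z) :
    zz_eq (zz_bwd Ww (zz_fwd w p)) p.

Fixpoint zz_cat (x y z : C) (p : zigzag x y) : zigzag y z -> zigzag x z :=
  match p in zigzag x y return zigzag y z -> zigzag x z with
  | zz_nil _ => fun r => r
  | zz_fwd _ _ _ f p => fun r => zz_fwd f (zz_cat p r)
  | zz_bwd _ _ _ _ Ww p => fun r => zz_bwd Ww (zz_cat p r)
  end.

Lemma zz_cat_congl (x y z : C) (p p' : zigzag x y) (r : zigzag y z) :
  zz_eq p p' -> zz_eq (zz_cat p r) (zz_cat p' r).
Proof.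
move=> e; elim: e r => /=.
- by move=> *; exact: zz_refl.
- by move=> *; exact/zz_sym.
- by move=> ? ? p1 p2 p3 _ h12 _ h23 r; exact: (zz_trans (h12 r) (h23 r)).
- by move=> *; exact/zz_congr_fwd.
- by move=> *; exact/zz_congr_bwd.
- by move=> *; exact: zz_id.
- by move=> *; exact: zz_comp.
- by move=> *; exact: zz_fwd_bwd.
- by move=> *; exact: zz_bwd_fwd.
Qed.

Lemma zz_cat_congr (x y z : C) (p : zigzag x y) (r r' : zigzag y z) :
  zz_eq r r' -> zz_eq (zz_cat p r) (zz_cat p r').
Proof.
elim: p r r' => //=.
- by move=> x' y' z' f p IH r r' /IH; exact: zz_congr_fwd.
- by move=> x' y' z' w Ww p IH r r' /IH; exact: zz_congr_bwd.
Qed.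

Lemma zz_catA (x y z t : C) (p : zigzag x y) (r : zigzag y z) (s : zigzag z t) :
  zz_cat p (zz_cat r s) = zz_cat (zz_cat p r) s.
Proof.
elim: p r s => //= [x' y' z' f p IH|x' y' z' w Ww p IH] r s; by rewrite IH.
Qed.

Lemma zz_cat0 (x y : C) (p : zigzag x y) : zz_cat p (zz_nil y) = p.
Proof.
by elim: p => //= [x' y' z' f p IH|x' y' z' w Ww p IH]; rewrite IH.
Qed.

(** An equivalence class is the predicate it defines: [{eq_quot _}] would put
    the large type [zigzag] in the universe of [choiceType]. *)
Definition loc_hom (x y : C) :=
  {P : zigzag x y -> Prop | exists p, P = zz_eq p}.

Definition loc_class (x y : C) (p : zigzag x y) : loc_hom x y :=
  exist _ (zz_eq p) (ex_intro _ p erefl).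

Lemma zz_eqE (x y : C) (p p' : zigzag x y) :
  zz_eq p p' <-> zz_eq p = zz_eq p'.
Proof.
split=> [e|->]; last exact: zz_refl.
apply: funext => r; apply: propext; split=> h.
- exact: zz_trans (zz_sym e) h.
- exact: zz_trans e h.
Qed.

Lemma loc_classP (x y : C) (p p' : zigzag x y) :
  loc_class p = loc_class p' <-> zz_eq p p'.
Proof.
rewrite zz_eqE; split=> [[]//|e].
exact: eq_exist.
Qed.

Lemma loc_class_surj (x y : C) (f : loc_hom x y) : exists p, f = loc_class p.
Proof. by case: f => P [p eP]; exists p; exact: eq_exist. Qed.

Lemma loc_comp_subproof (x y z : C) (g : loc_hom y z) (f : loc_hom x y) :
  exists p, (fun r => exists p1 p2,
    [/\ sval f p1, sval g p2 & zz_eq (zz_cat p1 p2) r]) = zz_eq p.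
Proof.
have [p ->] := loc_class_surj f; have [p' ->] := loc_class_surj g.
exists (zz_cat p p') => /=; apply: funext => r; apply: propext; split.
- case=> [p1 [p2 [e1 e2 e]]]; apply: zz_trans e.
  exact: (zz_trans (zz_cat_congl _ e1) (zz_cat_congr _ e2)).
- by move=> e; exists p, p'; split=> //; exact: zz_refl.
Qed.

Definition loc_comp (x y z : C) (g : loc_hom y z) (f : loc_hom x y) :
  loc_hom x z := exist _ _ (loc_comp_subproof g f).

Lemma loc_compE (x y z : C) (p : zigzag x y) (r : zigzag y z) :
  loc_comp (loc_class r) (loc_class p) = loc_class (zz_cat p r).
Proof.
apply: eq_exist => /=; apply: funext => s; apply: propext; split.
- case=> [p1 [p2 [e1 e2 e]]]; apply: zz_trans e.
  exact: (zz_trans (zz_cat_congl _ e1) (zz_cat_congr _ e2)).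
- by move=> e; exists p, r; split=> //; exact: zz_refl.
Qed.

Definition localisation : category.
Proof.
refine (@Category C loc_hom (fun x => loc_class (zz_nil x)) loc_comp _ _ _).
- move=> x y z t h g f.
  have [p ->] := loc_class_surj f; have [p' ->] := loc_class_surj g.
  by have [p'' ->] := loc_class_surj h; rewrite !loc_compE zz_catA.
- by move=> x y f; have [p ->] := loc_class_surj f; rewrite loc_compE zz_cat0.
- by move=> x y f; have [p ->] := loc_class_surj f; rewrite loc_compE.
Defined.

End Localisation.

(** A [Z]-graded module is a family of modules indexed by [int].  The indices
    of a product or of a differential are tied by an equation between integers,
    so that the axioms below involve no transport; these equations are proof
    irrelevant. *)

Section DG.
Variable k : comPzRingType.
Implicit Types i j l m n ij jl : int.

Lemma linear_fun0 (V W : lmodType k) (f : V -> W) : linear f -> f 0 = 0.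
Proof. by move=> /(_ (-1) 0 0); rewrite scaler0 addr0 scaleN1r addNr. Qed.

Record dgAlg := DGAlg {
  gr :> int -> lmodType k;
  dg_one : gr 0;
  dg_mul : forall i j n, i + j = n -> gr i -> gr j -> gr n;
  dg_diff : forall m n, m + 1 = n -> gr n -> gr m;
  dg_mul_linearl : forall i j n (e : i + j = n) (b : gr j),
    linear (fun a => dg_mul e a b);
  dg_mul_linearr : forall i j n (e : i + j = n) (a : gr i),
    linear (dg_mul e a);
  dg_mulA : forall i j l ij jl n (eij : i + j = ij) (ejl : j + l = jl)
    (e : i + jl = n) (e' : ij + l = n) (a : gr i) (b : gr j) (c : gr l),
    dg_mul e a (dg_mul ejl b c) = dg_mul e' (dg_mul eij a b) c;
  dg_mul1l : forall n (e : 0 + n = n) (a : gr n), dg_mul e dg_one a = a;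
  dg_mul1r : forall n (e : n + 0 = n) (a : gr n), dg_mul e a dg_one = a;
  dg_diff_linear : forall m n (e : m + 1 = n), linear (dg_diff e);
  dg_diff_diff : forall l m n (e : m + 1 = n) (e' : l + 1 = m) (a : gr n),
    dg_diff e' (dg_diff e a) = 0;
  dg_leibniz : forall i i' j j' n n' (e : i + j = n) (en : n' + 1 = n)
    (ei : i' + 1 = i) (ej : j' + 1 = j) (e1 : i' + j = n') (e2 : i + j' = n')
    (a : gr i) (b : gr j),
    dg_diff en (dg_mul e a b) =
      dg_mul e1 (dg_diff ei a) b +
      (-1) ^+ `|i|%N *: dg_mul e2 a (dg_diff ej b) }.

Record dgHom (A B : dgAlg) := DGHom {
  dg_fun :> forall n, A n -> B n;
  dg_fun_linear : forall n, linear (@dg_fun n);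
  dg_fun_one : dg_fun (dg_one A) = dg_one B;
  dg_fun_mul : forall i j n (e : i + j = n) (a : A i) (b : A j),
    dg_fun (dg_mul e a b) = dg_mul e (dg_fun a) (dg_fun b);
  dg_fun_diff : forall m n (e : m + 1 = n) (a : A n),
    dg_fun (dg_diff e a) = dg_diff e (dg_fun a) }.

HB.instance Definition _ (A : dgAlg) m n (e : m + 1 = n) :=
  GRing.isLinear.Build k (A n) (A m) *:%R (@dg_diff A m n e)
    (@dg_diff_linear A m n e).

HB.instance Definition _ (A : dgAlg) i j n (e : i + j = n) (a : A i) :=
  GRing.isLinear.Build k (A j) (A n) *:%R (@dg_mul A i j n e a)
    (@dg_mul_linearr A i j n e a).

HB.instance Definition _ (A B : dgAlg) (f : dgHom A B) n :=
  GRing.isLinear.Build k (A n) (B n) *:%R (@dg_fun A B f n)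
    (@dg_fun_linear A B f n).

Lemma dgHom_eq (A B : dgAlg) (f g : dgHom A B) :
  (forall n (a : A n), f n a = g n a) -> f = g.
Proof.
case: f g => [f f1 f2 f3 f4] [g g1 g2 g3 g4] /= fg.
have E : f = g by apply: functional_extensionality_dep => n; exact: funext.
by case: _ / E in g1 g2 g3 g4 *; congr DGHom; exact: Prop_irrelevance.
Qed.

Definition dg_id (A : dgAlg) : dgHom A A.
Proof. by refine (@DGHom A A (fun n a => a) _ _ _ _). Defined.

Definition dg_comp (A B C : dgAlg) (g : dgHom B C) (f : dgHom A B) : dgHom A C.
Proof.
refine (@DGHom A C (fun n a => g n (f n a)) _ _ _ _).
- by move=> n c a b; rewrite !linearP.
- by rewrite !dg_fun_one.
- by move=> *; rewrite !dg_fun_mul.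
- by move=> *; rewrite !dg_fun_diff.
Defined.

Definition dgCat : category.
Proof.
by refine (@Category dgAlg dgHom dg_id dg_comp _ _ _) => *; exact: dgHom_eq.
Defined.

Section Homology.
Variable A : dgAlg.

(** [is_cycleP]: the choice of the equation [n - 1 + 1 = n] is immaterial. *)
Definition is_cycle n : {pred A n} :=
  fun z => dg_diff (subrK 1 n : n - 1 + 1 = n) z == 0.

Lemma is_cycleP n (z : A n) :
  reflect (forall m (e : m + 1 = n), dg_diff e z = 0) (is_cycle z).
Proof.
apply: (iffP eqP) => [dz m e|]; last exact.
have E : m = n - 1 by rewrite -e addrK.
by subst m; rewrite (eq_irrelevance e (subrK 1 n)).
Qed.

Fact is_cycle_submod n : submod_closed (@is_cycle n).
Proof.
split=> [|c x y /eqP dx /eqP dy]; apply/eqP.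
- by rewrite linear0.
- by rewrite dg_diff_linear dx dy scaler0 addr0.
Qed.

HB.instance Definition _ n :=
  GRing.isSubmodClosed.Build k (A n) (@is_cycle n) (@is_cycle_submod n).

Definition cycles n := {z : A n | is_cycle z}.
HB.instance Definition _ n := SubChoice.on (cycles n).
HB.instance Definition _ n := [SubChoice_isSubLmodule of cycles n by <:].

Definition Cycles n (z : A n) (dz : is_cycle z) : cycles n := exist _ z dz.

Definition is_boundary n : {pred cycles n} :=
  fun z => `[< exists y : A (n + 1), dg_diff erefl y = val z >].

Fact is_boundary_zmod n : zmod_closed (@is_boundary n).
Proof.
split=> [|x y /asboolP [a ea] /asboolP [b eb]]; apply/asboolP.
- by exists 0; rewrite !linear0.
- by exists (a - b); rewrite linearB /= ea eb.
Qed.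

HB.instance Definition _ n :=
  GRing.isZmodClosed.Build (cycles n) (@is_boundary n) (@is_boundary_zmod n).

Definition homology n : zmodType := Quotient.quot (@is_boundary n).

Definition hclass n (z : cycles n) : homology n := \pi z.

Lemma hclassP n (z z' : cycles n) :
  hclass z = hclass z' <->
  exists y : A (n + 1), dg_diff erefl y = val z - val z'.
Proof.
rewrite /hclass; split.
- move=> /eqP; rewrite -Quotient.idealrBE => /asboolP [y ey].
  by exists y; rewrite ey linearB.
- move=> [y ey]; apply/eqP; rewrite -Quotient.idealrBE; apply/asboolP.
  by exists y; rewrite ey linearB.
Qed.

Lemma hclass_surj n (x : homology n) : exists z, x = hclass z.
Proof. by exists (repr x); rewrite /hclass reprK. Qed.

Lemma cycle_one_subproof : is_cycle (dg_one A).
Proof.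
apply/is_cycleP => m e.
have := dg_leibniz (addr0 0) e e e (addr0 m) (add0r m) (dg_one A) (dg_one A).
rewrite !dg_mul1l dg_mul1r expr0 scale1r => /eqP.
by rewrite -subr_eq0 opprD addrA subrr sub0r oppr_eq0 => /eqP.
Qed.

Definition cycle_one : cycles 0 := Cycles cycle_one_subproof.

Lemma cycle_mul_subproof i j n (e : i + j = n) (a : cycles i) (b : cycles j) :
  is_cycle (dg_mul e (val a) (val b)).
Proof.
apply/is_cycleP => m en.
have e1 : i - 1 + j = m by rewrite addrAC e -en addrK.
have e2 : i + (j - 1) = m by rewrite addrA e -en addrK.
rewrite (dg_leibniz e en (subrK 1 i) (subrK 1 j) e1 e2).
rewrite (is_cycleP (val a) (valP a)) (is_cycleP (val b) (valP b)).
rewrite linear0 scaler0 addr0.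
exact: linear_fun0 (dg_mul_linearl e1 (val b)).
Qed.

Definition cycle_mul i j n (e : i + j = n) (a : cycles i) (b : cycles j) :
  cycles n := Cycles (cycle_mul_subproof e a b).

Definition hone : homology 0 := hclass cycle_one.

(** Through representatives; [hmulE] and [hmapE] give the values on classes. *)
Definition hmul i j n (e : i + j = n) (x : homology i) (y : homology j) :
  homology n := hclass (cycle_mul e (repr x) (repr y)).

(** An inverse in the graded ring [H(A)] of an element of degree [n] is
    necessarily of degree [-n]. *)
Definition hinvertible n (x : homology n) : Prop :=
  exists y : homology (- n),
    hmul (subrr n) x y = hone /\ hmul (addNr n) y x = hone.

End Homology.

Lemma cycle_map_subproof (A B : dgAlg) (f : dgHom A B) n (z : cycles A n) :
  is_cycle (f n (val z)).
Proof.
apply/is_cycleP => m e.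
by rewrite -dg_fun_diff (is_cycleP (val z) (valP z)) linear0.
Qed.

Definition cycle_map (A B : dgAlg) (f : dgHom A B) n (z : cycles A n) :
  cycles B n := Cycles (cycle_map_subproof f z).

Definition hmap (A B : dgAlg) (f : dgHom A B) n (x : homology A n) :
  homology B n := hclass (cycle_map f (repr x)).

Lemma hmapE (A B : dgAlg) (f : dgHom A B) n (z : cycles A n) :
  hmap f (hclass z) = hclass (cycle_map f z).
Proof.
apply/hclassP.
have /hclassP [y ey] : hclass (repr (hclass z)) = hclass z.
  by rewrite /hclass reprK.
by exists (f _ y); rewrite -dg_fun_diff ey linearB.
Qed.

Lemma hmulE (A : dgAlg) i j n (e : i + j = n) (a : cycles A i) (b : cycles A j) :
  hmul e (hclass a) (hclass b) = hclass (cycle_mul e a b).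
Proof.
apply/hclassP => /=.
have /hclassP [x ex] : hclass (repr (hclass a)) = hclass a.
  by rewrite /hclass reprK.
have /hclassP [y ey] : hclass (repr (hclass b)) = hclass b.
  by rewrite /hclass reprK.
set a' := val (repr _) in ex *; set b' := val (repr _) in ey *.
have e1 : i + 1 + j = n + 1 by rewrite addrAC e.
have e2 : i + (j + 1) = n + 1 by rewrite addrA e.
exists (dg_mul e1 x b' + (-1) ^+ `|i|%N *: dg_mul e2 (val a) y).
rewrite linearD linearZ /=.
have e3 : i + 1 + (j - 1) = n by rewrite addrACA subrr addr0.
have e4 : i - 1 + (j + 1) = n by rewrite addrACA addNr addr0.
rewrite (dg_leibniz e1 _ erefl (subrK 1 j) e e3) ex.
rewrite (is_cycleP b' (valP (repr (hclass b)))) linear0 scaler0 addr0.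
rewrite (dg_leibniz e2 _ (subrK 1 i) erefl e4 e) ey.
rewrite (is_cycleP (val a) (valP a)).
rewrite (linear_fun0 (dg_mul_linearl e4 y)).
rewrite add0r scalerA -exprD -signr_odd oddD addbb expr0 scale1r linearB.
have := dg_mul_linearl e b' (-1) (val a) a'.
rewrite !scaleN1r ![- _ + _]addrC => ->.
by rewrite addrA subrK.
Qed.

Definition quasi_iso : hom_class dgCat :=
  fun A B f => forall n, bijective (@hmap A B f n).

Definition fibration : hom_class dgCat :=
  fun A B f => forall n (b : gr B n), exists a : gr A n, dg_fun f a = b.

Definition cofibration : hom_class dgCat :=
  fun A B (i : hom A B) => forall (X Y : dgCat) (p : hom X Y),
    fibration p -> quasi_iso p -> left_lifting i p.

Definition cofibrant (Q : dgCat) : Prop :=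
  forall (I : dgCat) (u : hom I Q),
    initial_among (fun _ => True) I -> cofibration u.

Record cof_repl (A : dgCat) := CofRepl {
  repl_ob : dgCat;
  repl_map : hom repl_ob A;
  repl_cofibrant : cofibrant repl_ob;
  repl_quasi_iso : quasi_iso repl_map }.

Definition derived_under (A : dgCat) (Q : cof_repl A) : category :=
  localisation (under_class (q := repl_ob Q) quasi_iso).

(** A set of homogeneous homology classes, as a family of subsets of the
    [homology A n]: a homogeneous class carries its degree, so that zero classes
    of different degrees are different. *)
Definition hset (A : dgAlg) := forall n, set (homology A n).

(** Since [H(Q) -> H(A)] is bijective, [x] below is the class of [H(Q)]
    corresponding to [s]. *)
Definition inverting (A : dgCat) (S : hset A) (Q : cof_repl A)
    (Y : derived_under Q) : Prop :=
  forall n (s : homology A n), S n s ->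
  forall x : homology (repl_ob Q) n, hmap (repl_map Q) x = s ->
    hinvertible (hmap (under_map Y) x).

Definition is_derived_localisation (A : dgCat) (S : hset A) (Q : cof_repl A)
    (L : derived_under Q) : Prop :=
  initial_among (inverting S (Q := Q)) L.

(** For [phi : A -> B] and [psi : A -> C], the value at [C] of the total left
    derived functor of [P *_Q -], as an object of the derived under category
    of [B] computed with [P].  Here [Q -> A] and [Q >-> P -> B] are cofibrant
    replacements, and [Q >-> C' -> C] is a cofibrant replacement of [C] in the
    category of dg algebras under [Q]. *)
Definition is_derived_free_product (A B C : dgCat)
    (phi : hom A B) (psi : hom A C) (P : cof_repl B)
    (X : derived_under P) : Prop :=
  exists (Q : cof_repl A) (i : hom (repl_ob Q) (repl_ob P))
         (C' : dgCat) (j : hom (repl_ob Q) C') (r : hom C' C)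
         (g : hom C' (under_tgt X)),
    [/\ cofibration i /\ repl_map P \oc i = phi \oc repl_map Q,
        cofibration j, quasi_iso r, r \oc j = psi \oc repl_map Q
      & is_pushout i j (under_map X) g].

Section Presentation.
Variables (G : Type) (deg : G -> int).

Inductive gterm : int -> Type :=
| TGen g : gterm (deg g)
| TZero n : gterm n
| TAdd n : gterm n -> gterm n -> gterm n
| TScale n : k -> gterm n -> gterm n
| TOne : gterm 0
| TMul i j n : i + j = n -> gterm i -> gterm j -> gterm n.

Variable R : forall n, gterm n -> gterm n -> Prop.

Inductive pres_eq : forall n, gterm n -> gterm n -> Prop :=
| pe_rel n (t u : gterm n) : R t u -> pres_eq t u
| pe_refl n (t : gterm n) : pres_eq t t
| pe_sym n (t u : gterm n) : pres_eq t u -> pres_eq u t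
| pe_trans n (t u v : gterm n) : pres_eq t u -> pres_eq u v -> pres_eq t v
| pe_congr_add n (t t' u u' : gterm n) :
    pres_eq t t' -> pres_eq u u' -> pres_eq (TAdd t u) (TAdd t' u')
| pe_congr_scale n c (t t' : gterm n) :
    pres_eq t t' -> pres_eq (TScale c t) (TScale c t')
| pe_congr_mul i j n (e : i + j = n) (t t' : gterm i) (u u' : gterm j) :
    pres_eq t t' -> pres_eq u u' -> pres_eq (TMul e t u) (TMul e t' u')
| pe_addA n (t u v : gterm n) :
    pres_eq (TAdd t (TAdd u v)) (TAdd (TAdd t u) v)
| pe_addC n (t u : gterm n) : pres_eq (TAdd t u) (TAdd u t)
| pe_add0 n (t : gterm n) : pres_eq (TAdd (TZero n) t) t
| pe_addN n (t : gterm n) : pres_eq (TAdd (TScale (-1) t) t) (TZero n)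
| pe_scaleA n b c (t : gterm n) :
    pres_eq (TScale b (TScale c t)) (TScale (b * c) t)
| pe_scale1 n (t : gterm n) : pres_eq (TScale 1 t) t
| pe_scaleDr n c (t u : gterm n) :
    pres_eq (TScale c (TAdd t u)) (TAdd (TScale c t) (TScale c u))
| pe_scaleDl n b c (t : gterm n) :
    pres_eq (TScale (b + c) t) (TAdd (TScale b t) (TScale c t))
| pe_mulDl i j n (e : i + j = n) (t u : gterm i) (v : gterm j) :
    pres_eq (TMul e (TAdd t u) v) (TAdd (TMul e t v) (TMul e u v))
| pe_mulDr i j n (e : i + j = n) (t : gterm i) (u v : gterm j) :
    pres_eq (TMul e t (TAdd u v)) (TAdd (TMul e t u) (TMul e t v))
| pe_mulZl i j n (e : i + j = n) c (t : gterm i) (u : gterm j) :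
    pres_eq (TMul e (TScale c t) u) (TScale c (TMul e t u))
| pe_mulZr i j n (e : i + j = n) c (t : gterm i) (u : gterm j) :
    pres_eq (TMul e t (TScale c u)) (TScale c (TMul e t u))
| pe_mulA i j l ij jl n (eij : i + j = ij) (ejl : j + l = jl)
    (e : i + jl = n) (e' : ij + l = n)
    (t : gterm i) (u : gterm j) (v : gterm l) :
    pres_eq (TMul e t (TMul ejl u v)) (TMul e' (TMul eij t u) v)
| pe_mul1l n (e : 0 + n = n) (t : gterm n) : pres_eq (TMul e TOne t) t
| pe_mul1r n (e : n + 0 = n) (t : gterm n) : pres_eq (TMul e t TOne) t.

HB.instance Definition _ n := gen_eqMixin (gterm n).
HB.instance Definition _ n := gen_choiceMixin (gterm n).

Definition pres_rel n : rel (gterm n) := fun t u => `[< pres_eq t u >].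

Fact pres_rel_equiv n : equiv_class_of (@pres_rel n).
Proof.
split=> [t|t u|u t v].
- exact/asboolP/pe_refl.
- by apply/asboolP/asboolP; exact: pe_sym.
- by move=> /asboolP tu /asboolP uv; apply/asboolP; exact: (pe_trans tu uv).
Qed.

Canonical pres_equiv n := EquivRelPack (@pres_rel_equiv n).
Canonical pres_encModRel n := defaultEncModRel (@pres_rel n).

Definition pres n := {eq_quot (@pres_rel n)}.
HB.instance Definition _ n := Choice.on (pres n).
HB.instance Definition _ n : EqQuotient (gterm n) (@pres_rel n) (pres n) :=
  EqQuotient.on (pres n).

Definition pcls n (t : gterm n) : pres n := \pi t.

Lemma pclsP n (t u : gterm n) : pcls t = pcls u <-> pres_eq t u.
Proof.
rewrite /pcls; split=> [/eqquotP /asboolP //|h].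
by apply/eqquotP/asboolP.
Qed.

Lemma pcls_surj n (x : pres n) : exists t, x = pcls t.
Proof. by exists (repr x); rewrite /pcls reprK. Qed.

Lemma repr_pcls n (t : gterm n) : pres_eq (repr (pcls t)) t.
Proof. by apply/pclsP; rewrite /pcls reprK. Qed.

Definition pres_add n (x y : pres n) : pres n := pcls (TAdd (repr x) (repr y)).
Definition pres_scale n (c : k) (x : pres n) : pres n :=
  pcls (TScale c (repr x)).
Definition pres_opp n (x : pres n) : pres n := pres_scale (-1) x.
Definition pres_mul i j n (e : i + j = n) (x : pres i) (y : pres j) : pres n :=
  pcls (TMul e (repr x) (repr y)).

Lemma pres_addE n (t u : gterm n) :
  pres_add (pcls t) (pcls u) = pcls (TAdd t u).
Proof. by apply/pclsP; apply: pe_congr_add; exact: repr_pcls. Qed.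

Lemma pres_scaleE n c (t : gterm n) :
  pres_scale c (pcls t) = pcls (TScale c t).
Proof. by apply/pclsP; apply: pe_congr_scale; exact: repr_pcls. Qed.

Lemma pres_mulE i j n (e : i + j = n) (t : gterm i) (u : gterm j) :
  pres_mul e (pcls t) (pcls u) = pcls (TMul e t u).
Proof. by apply/pclsP; apply: pe_congr_mul; exact: repr_pcls. Qed.

Fact pres_addA n : associative (@pres_add n).
Proof.
move=> x y z; have [t ->] := pcls_surj x; have [u ->] := pcls_surj y.
have [v ->] := pcls_surj z; rewrite !pres_addE; apply/pclsP; exact: pe_addA.
Qed.

Fact pres_addC n : commutative (@pres_add n).
Proof.
move=> x y; have [t ->] := pcls_surj x; have [u ->] := pcls_surj y.
rewrite !pres_addE; apply/pclsP; exact: pe_addC.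
Qed.

Fact pres_add0 n : left_id (pcls (TZero n)) (@pres_add n).
Proof.
move=> x; have [t ->] := pcls_surj x.
rewrite pres_addE; apply/pclsP; exact: pe_add0.
Qed.

Fact pres_addN n :
  left_inverse (pcls (TZero n)) (@pres_opp n) (@pres_add n).
Proof.
move=> x; have [t ->] := pcls_surj x.
rewrite /pres_opp pres_scaleE pres_addE; apply/pclsP; exact: pe_addN.
Qed.

HB.instance Definition _ n := GRing.isZmodule.Build (pres n)
  (@pres_addA n) (@pres_addC n) (@pres_add0 n) (@pres_addN n).

Fact pres_scaleA n b c (x : pres n) :
  pres_scale b (pres_scale c x) = pres_scale (b * c) x.
Proof.
have [t ->] := pcls_surj x.
rewrite !pres_scaleE; apply/pclsP; exact: pe_scaleA.
Qed.

Fact pres_scale1 n : left_id 1 (@pres_scale n).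
Proof.
move=> x; have [t ->] := pcls_surj x.
rewrite !pres_scaleE; apply/pclsP; exact: pe_scale1.
Qed.

Fact pres_scaleDr n : right_distributive (@pres_scale n) +%R.
Proof.
move=> c x y; have [t ->] := pcls_surj x; have [u ->] := pcls_surj y.
rewrite /GRing.add /= !(pres_addE, pres_scaleE).
apply/pclsP; exact: pe_scaleDr.
Qed.

Fact pres_scaleDl n (x : pres n) : {morph (@pres_scale n)^~ x : b c / b + c}.
Proof.
move=> b c; have [t ->] := pcls_surj x.
rewrite [RHS]/GRing.add /= !(pres_addE, pres_scaleE).
apply/pclsP; exact: pe_scaleDl.
Qed.

HB.instance Definition _ n := GRing.Zmodule_isLmodule.Build k (pres n)
  (@pres_scaleA n) (@pres_scale1 n) (@pres_scaleDr n) (@pres_scaleDl n).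

Lemma pclsD n (t u : gterm n) : pcls (TAdd t u) = pcls t + pcls u.
Proof. by rewrite -pres_addE. Qed.

Lemma pclsZ n c (t : gterm n) : pcls (TScale c t) = c *: pcls t.
Proof. by rewrite -pres_scaleE. Qed.

Lemma pcls0 n : pcls (TZero n) = 0.
Proof. by []. Qed.

Fact pres_mul_linearl i j n (e : i + j = n) (y : pres j) :
  linear ((@pres_mul i j n e)^~ y).
Proof.
move=> c x x'; have [t ->] := pcls_surj x; have [t' ->] := pcls_surj x'.
have [u ->] := pcls_surj y.
rewrite -pclsZ -pclsD !pres_mulE -pclsZ -pclsD; apply/pclsP.
apply: pe_trans (pe_mulDl _ _ _ _) _.
by apply: pe_congr_add; [exact: pe_mulZl | exact: pe_refl].
Qed.

Fact pres_mul_linearr i j n (e : i + j = n) (y : pres i) :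
  linear (pres_mul e y).
Proof.
move=> c x x'; have [t ->] := pcls_surj x; have [t' ->] := pcls_surj x'.
have [u ->] := pcls_surj y.
rewrite -pclsZ -pclsD !pres_mulE -pclsZ -pclsD; apply/pclsP.
apply: pe_trans (pe_mulDr _ _ _ _) _.
by apply: pe_congr_add; [exact: pe_mulZr | exact: pe_refl].
Qed.

(** The graded algebra with generators [G] and relations [R], with zero
    differential. *)
Definition pres_alg : dgAlg.
Proof.
refine (@DGAlg pres (pcls TOne) pres_mul (fun m n _ _ => 0)
  pres_mul_linearl pres_mul_linearr _ _ _ _ _ _).
- move=> i j l ij jl n eij ejl e e' x y z; have [t ->] := pcls_surj x.
  have [u ->] := pcls_surj y; have [v ->] := pcls_surj z.
  rewrite !pres_mulE; apply/pclsP; exact: pe_mulA.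
- move=> n e x; have [t ->] := pcls_surj x.
  rewrite pres_mulE; apply/pclsP; exact: pe_mul1l.
- move=> n e x; have [t ->] := pcls_surj x.
  rewrite pres_mulE; apply/pclsP; exact: pe_mul1r.
- by move=> m n _ c x y; rewrite scaler0 addr0.
- by [].
- move=> i i' j j' n n' e en ei ej e1 e2 x y.
  rewrite (linear_fun0 (pres_mul_linearl e1 y)).
  by rewrite (linear_fun0 (pres_mul_linearr e2 x)) scaler0 addr0.
Defined.

Definition pgen (g : G) : pres_alg (deg g) := pcls (TGen g).

Section Eval.
Variables (B : dgAlg) (b : forall g, B (deg g)).

Fixpoint geval n (t : gterm n) : B n :=
  match t in gterm n return B n with
  | TGen g => b g
  | TZero _ => 0
  | TAdd _ t u => geval t + geval u
  | TScale _ c t => c *: geval t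
  | TOne => dg_one B
  | TMul _ _ _ e t u => dg_mul e (geval t) (geval u)
  end.

Hypothesis b_cycle : forall g, is_cycle (b g).
Hypothesis b_rel : forall n (t u : gterm n), R t u -> geval t = geval u.

Lemma geval_eq n (t u : gterm n) : pres_eq t u -> geval t = geval u.
Proof.
elim=> {n t u} /=.
- exact: b_rel.
- by [].
- by [].
- by move=> n t u v _ -> _ ->.
- by move=> n t t' u u' _ -> _ ->.
- by move=> n c t t' _ ->.
- by move=> i j n e t t' u u' _ -> _ ->.
- by move=> *; exact: addrA.
- by move=> *; exact: addrC.
- by move=> *; exact: add0r.
- by move=> *; rewrite scaleN1r addNr.
- by move=> *; exact: scalerA.
- by move=> *; exact: scale1r.
- by move=> *; exact: scalerDr.
- by move=> *; exact: scalerDl.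
- move=> i j n e t u v; have := dg_mul_linearl e (geval v) 1 (geval t) (geval u).
  by rewrite !scale1r.
- by move=> *; exact: linearD.
- move=> i j n e c t u; have := dg_mul_linearl e (geval u) c (geval t) 0.
  by rewrite (linear_fun0 (dg_mul_linearl e (geval u))) !addr0.
- by move=> *; exact: linearZ.
- by move=> *; exact: dg_mulA.
- by move=> *; exact: dg_mul1l.
- by move=> *; exact: dg_mul1r.
Qed.

Lemma geval_cycle n (t : gterm n) : is_cycle (geval t).
Proof.
elim: t => {n} /=.
- exact: b_cycle.
- by move=> n; exact: (valP (0 : cycles B n)).
- by move=> n t ht u hu; exact: (valP (Cycles ht + Cycles hu)).
- by move=> n c t ht; exact: (valP (c *: Cycles ht)).
- exact: (valP (cycle_one B)).
- move=> i j n e t ht u hu.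
  exact: (valP (cycle_mul e (Cycles ht) (Cycles hu))).
Qed.

Definition pres_lift : dgHom pres_alg B.
Proof.
refine (@DGHom pres_alg B (fun n (x : pres n) => geval (repr x)) _ _ _ _).
- move=> n c x y; have [t ->] := pcls_surj x; have [u ->] := pcls_surj y.
  rewrite -pclsZ -pclsD (geval_eq (repr_pcls _)) /=.
  by rewrite -(geval_eq (repr_pcls t)) -(geval_eq (repr_pcls u)).
- exact: geval_eq (repr_pcls TOne).
- by move=> i j n e x y; exact: geval_eq (repr_pcls _).
- move=> m n e x; rewrite (is_cycleP _ (geval_cycle _)).
  exact: geval_eq (repr_pcls (TZero m)).
Defined.

Lemma pres_liftE g : pres_lift _ (pgen g) = b g.
Proof. exact: geval_eq (repr_pcls (TGen g)). Qed.

Lemma pres_lift_uniq (f : dgHom pres_alg B) :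
  (forall g, f _ (pgen g) = b g) -> f = pres_lift.
Proof.
move=> fg; apply: dgHom_eq => n x; have [t ->] := pcls_surj x.
rewrite [RHS](geval_eq (repr_pcls t)).
elim: t => {n x} /=.
- exact: fg.
- by move=> n; exact: (linear0 (f n)).
- by move=> n t ht u hu; rewrite pclsD linearD /= ht hu.
- by move=> n c t ht; rewrite pclsZ linearZ /= ht.
- exact: (dg_fun_one f).
- move=> i j n e t ht u hu; rewrite -pres_mulE.
  by rewrite (dg_fun_mul f e (pcls t : pres_alg i) (pcls u)) ht hu.
Qed.

End Eval.

Lemma is_cycle_pres n (x : pres_alg n) : is_cycle x.
Proof. by apply/is_cycleP. Qed.

End Presentation.

Section Free.
Variables (G : Type) (deg : G -> int).

Definition no_rel n : gterm deg n -> gterm deg n -> Prop := fun _ _ => False.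

Definition free_alg : dgAlg := pres_alg no_rel.

Definition deg_inv (g : G + G) : int :=
  match g with inl s => deg s | inr s => - deg s end.

(** [inl s] stands for the symbol [s] and [inr s] for the symbol [s^-1]. *)
Inductive inv_rel : forall n, gterm deg_inv n -> gterm deg_inv n -> Prop :=
| inv_rel_r s : inv_rel
    (TMul (subrr (deg s)) (TGen deg_inv (inl s)) (TGen deg_inv (inr s)))
    (TOne deg_inv)
| inv_rel_l s : inv_rel
    (TMul (addNr (deg s)) (TGen deg_inv (inr s)) (TGen deg_inv (inl s)))
    (TOne deg_inv).

Definition free_inv_alg : dgAlg := pres_alg inv_rel.

Definition free_lift (B : dgAlg) (b : forall g, cycles B (deg g)) :
    dgHom free_alg B :=
  pres_lift (R := no_rel) (b := fun g => val (b g)) (fun g => valP (b g))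
    (fun _ _ _ r => match r with end).

Definition free_to_inv : dgHom free_alg free_inv_alg :=
  free_lift (fun g => Cycles (is_cycle_pres (pgen inv_rel (inl g)))).

End Free.

Lemma dgCat_initial :
  initial_among (C := dgCat) (fun _ => True) (free_alg (of_void int)).
Proof.
split=> // B _; exists (free_lift (B := B) (fun g => of_void _ g)).
by split=> // f _; apply/esym/pres_lift_uniq; case.
Qed.

Definition hset_gen (A : dgAlg) (S : hset A) :=
  {n : int & {s : homology A n | S n s}}.

Definition hset_deg (A : dgAlg) (S : hset A) (g : hset_gen S) : int := tag g.

End DG.

(* Main.v *)
Require Import Defs.
From mathcomp Require Import all_boot all_order all_algebra.
From HB Require Import structures.
From mathcomp Require Import zify boolp.

(** Write [F] for the free algebra on [S], [K] for the free algebra on [S] and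
    [S^-1], [Q -> F] for the cofibrant replacement and [Q >-> C -> K] for the
    factorisation of [Q -> F -> K], so that the derived free product is
    [X = P *_Q C].  Choose cycles [iota s] of [Q] over the generators [s] of
    [F].  An object [Y] under [P] is [S]-inverting when the images of the
    [iota s] are units of [H(Y)]; this holds for [X] because [C -> K] is a
    quasi-isomorphism.

    Initiality follows from one lifting property, [localising_lifting]: a
    square from [Q >-> C] to a surjection [E -> B] has a filler as soon as the
    [iota s] become units of [H(E)].  Applied to the projection
    [Y * C -> C], it gives a map [X -> Y] under [P] for each [S]-inverting
    [Y]; applied to the path algebra of [Y] over [Y * Y], it shows that two
    such maps are homotopic, hence equal in the derived under category.  Every
    zigzag out of [X] then reduces to a single map ([zigzag_strict]): at a
    backward quasi-isomorphism [w : Z' -> Z], any map [X -> Z'] composes with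
    [w] to a map that is homotopic to the given one.

    For the lifting property, [Q >-> C] is exhibited as a retract of an
    explicit extension.  [base_alg] is the free algebra on [S] with a
    contractible pair of generators [x], [dx] for each element of [Q].
    [hinv_alg] adjoins to it, for each [s], a cycle [t] and elements [h'],
    [h], [u] with
      dh' = st - 1,  dh = ts - 1,  du = sh - (-1)^|s| h's,
    and a contractible pair for each element of [C].  The pairs make the maps
    [base_alg -> Q] and [hinv_alg -> C] surjective, and these maps are
    quasi-isomorphisms; so they split, compatibly, by cofibrancy.  The element
    [u] is there because [(t, h')] and then [(h, u)] are each a solution of a
    linear equation in the cone of left multiplication by [s].  When that cone
    is acyclic on the kernel of [E -> B], both pairs lift from [B] to [E]
    ([inverse_data_lifting]); for triples [t, h, h'] alone this would fail.

    It remains to see that [hinv_alg -> K] is injective on homology, which is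
    the content of [hinv_alg_kernel_exact].  Let [Y] be [hinv_alg] and let [M]
    consist of the functions from reduced words in [S] and [S^-1] to [Y].  The
    algebra [K] acts on the left of [M] by translating words, [Y] acts on the
    right by multiplication, and [sigma] in [M] sends a word to its value in
    [Y], with [t] for [s^-1].  The matrices with diagonal in [K] and [Y] and
    corner in [M] form a dg algebra whose differential involves the commutator
    with [sigma] ([glue]).  The pair [(s, s)] extends to a cycle of it: the
    difference of [sigma(w) s] and [sigma(ws)] is zero unless [w = v s^-1], and
    is then [sigma(v) (ts - 1)], the boundary of [sigma(v) h] up to sign.  Since
    translation by [s] is bijective on [M], the cone condition holds, and the
    lifting property of [hinv_alg] yields a map to the triangular algebra with
    diagonal the projection to [K] and the identity.  At the empty word, its
    corner is a homotopy between [z] and the normal form of the image of [z] in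
    [K].  Hence a cycle that dies in [K] is a boundary. *)

Set Implicit Arguments.
Unset Strict Implicit.
Unset Printing Implicit Defensive.

Import GRing.Theory.

Local Open Scope ring_scope.
Local Open Scope cat_scope.

(** * Cancellation and signs *)

Lemma zmod_eq_sub (V : zmodType) (x y : V) : 0 + (x - y) = 0 -> x = y.
Proof. by rewrite add0r => /eqP; rewrite subr_eq0 => /eqP. Qed.

(** Proves an identity between sums in an abelian group by moving everything to
    one side and cancelling opposite terms pairwise. *)
Ltac zmodule :=
  apply: zmod_eq_sub;
  rewrite ?(scalerDr, scalerN, scaleNr, opprD, opprK, addrA, subr0, oppr0, addr0);
  repeat match goal with
  | |- _ - ?t = 0 =>
      repeat rewrite (addrAC _ t _); rewrite subrK
  | |- _ + ?t = 0 =>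
      repeat rewrite (addrAC _ (- t) _); rewrite addrK
  end; try done.

Section Signs.
Variable k : comPzRingType.
Implicit Types i j n : int.

Definition sg i : k := (-1) ^+ `|i|%N.

Lemma sgD i j : sg (i + j) = sg i * sg j.
Proof.
rewrite /sg -signr_odd -[X in X * _]signr_odd -[X in _ * X]signr_odd -signr_addb.
congr ((-1) ^+ nat_of_bool _).
by case: i j => i [] j; lia.
Qed.

Lemma sgN i : sg (- i) = sg i. Proof. by rewrite /sg abszN. Qed.

Lemma sg1 : sg 1 = -1. Proof. by rewrite /sg expr1. Qed.

Lemma sg0 : sg 0 = 1. Proof. by []. Qed.

Lemma sgK i : sg i * sg i = 1.
Proof. by rewrite -{2}sgN -sgD subrr. Qed.

(** Signs are compared through an explicit even difference [l + l]. *)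
Lemma sg_eq l i j : i = j + l + l -> sg i = sg j.
Proof. by move=> ->; rewrite !sgD -mulrA sgK mulr1. Qed.

Lemma sgZK (V : lmodType k) i (x : V) : sg i *: (sg i *: x) = x.
Proof. by rewrite scalerA sgK scale1r. Qed.

Lemma sgB1 i : sg (i - 1) = - sg i.
Proof. by rewrite sgD sgN sg1 mulrN1. Qed.

Lemma sgS m n : m + 1 = n -> sg m = - sg n.
Proof. by move=> <-; rewrite sgD sg1 mulrN1 opprK. Qed.
End Signs.

Section DgAlgebra.
Variables (k : comPzRingType) (A : dgAlg k).
Implicit Types i j l m n : int.

Lemma dmul0l i j n (e : i + j = n) (b : A j) : dg_mul e 0 b = 0.
Proof. exact: linear_fun0 (dg_mul_linearl e b). Qed.

Lemma dmulDl i j n (e : i + j = n) (a a' : A i) (b : A j) :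
  dg_mul e (a + a') b = dg_mul e a b + dg_mul e a' b.
Proof. by have := dg_mul_linearl e b 1 a a'; rewrite !scale1r. Qed.

Lemma dmulZl i j n (e : i + j = n) c (a : A i) (b : A j) :
  dg_mul e (c *: a) b = c *: dg_mul e a b.
Proof. by have := dg_mul_linearl e b c a 0; rewrite !addr0 dmul0l addr0. Qed.

Lemma dmulNl i j n (e : i + j = n) (a : A i) (b : A j) :
  dg_mul e (- a) b = - dg_mul e a b.
Proof. by rewrite -!scaleN1r dmulZl. Qed.

Lemma dmulBl i j n (e : i + j = n) (a a' : A i) (b : A j) :
  dg_mul e (a - a') b = dg_mul e a b - dg_mul e a' b.
Proof. by rewrite dmulDl dmulNl. Qed.

Lemma dg_diff_mul i i' j j' n n' (e : i + j = n) (en : n' + 1 = n)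
    (ei : i' + 1 = i) (ej : j' + 1 = j) (e1 : i' + j = n') (e2 : i + j' = n')
    (a : A i) (b : A j) :
  dg_diff en (dg_mul e a b) =
    dg_mul e1 (dg_diff ei a) b + sg k i *: dg_mul e2 a (dg_diff ej b).
Proof. exact: dg_leibniz. Qed.

Lemma dg_diff_one m (e : m + 1 = 0) : dg_diff e (dg_one A) = 0.
Proof. exact: (is_cycleP _ (cycle_one_subproof A)). Qed.

End DgAlgebra.

(** * Triangular dg algebras *)

Section Glue.
Variable k : comPzRingType.

(** The indices of an action or of the differential are tied by equations, as in
    [dgAlg], so that no axiom needs a transport. *)
Record bimod (A B : dgAlg k) := Bimod {
  bm :> int -> lmodType k;
  lact : forall i j n, i + j = n -> A i -> bm j -> bm n;
  ract : forall i j n, i + j = n -> bm i -> B j -> bm n;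
  bdiff : forall m n, m + 1 = n -> bm n -> bm m;
  lact_linearl : forall i j n (e : i + j = n) (z : bm j),
    linear (fun x => lact e x z);
  lact_linearr : forall i j n (e : i + j = n) (x : A i), linear (lact e x);
  ract_linearl : forall i j n (e : i + j = n) (y : B j),
    linear (fun z => ract e z y);
  ract_linearr : forall i j n (e : i + j = n) (z : bm i), linear (ract e z);
  bdiff_linear : forall m n (e : m + 1 = n), linear (bdiff e);
  lactA : forall i j l ij jl n (eij : i + j = ij) (ejl : j + l = jl)
    (e : i + jl = n) (e' : ij + l = n) (x : A i) (x' : A j) (z : bm l),
    lact e x (lact ejl x' z) = lact e' (dg_mul eij x x') z;
  lractA : forall i j l ij jl n (eij : i + j = ij) (ejl : j + l = jl)
    (e : i + jl = n) (e' : ij + l = n) (x : A i) (z : bm j) (y : B l),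
    lact e x (ract ejl z y) = ract e' (lact eij x z) y;
  ractA : forall i j l ij jl n (eij : i + j = ij) (ejl : j + l = jl)
    (e : i + jl = n) (e' : ij + l = n) (z : bm i) (y : B j) (y' : B l),
    ract e z (dg_mul ejl y y') = ract e' (ract eij z y) y';
  lact1 : forall n (e : 0 + n = n) (z : bm n), lact e (dg_one A) z = z;
  ract1 : forall n (e : n + 0 = n) (z : bm n), ract e z (dg_one B) = z;
  bdiff_bdiff : forall l m n (e : m + 1 = n) (e' : l + 1 = m) (z : bm n),
    bdiff e' (bdiff e z) = 0;
  lact_leibniz : forall i i' j j' n n' (e : i + j = n) (en : n' + 1 = n)
    (ei : i' + 1 = i) (ej : j' + 1 = j) (e1 : i' + j = n') (e2 : i + j' = n')
    (x : A i) (z : bm j),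
    bdiff en (lact e x z) =
      lact e1 (dg_diff ei x) z + sg k i *: lact e2 x (bdiff ej z);
  ract_leibniz : forall i i' j j' n n' (e : i + j = n) (en : n' + 1 = n)
    (ei : i' + 1 = i) (ej : j' + 1 = j) (e1 : i' + j = n') (e2 : i + j' = n')
    (z : bm i) (y : B j),
    bdiff en (ract e z y) =
      ract e1 (bdiff ei z) y + sg k i *: ract e2 z (dg_diff ej y) }.

Section BimodTheory.
Variables (A B : dgAlg k) (M : bimod A B).

HB.instance Definition _ i j n (e : i + j = n) (x : A i) :=
  GRing.isLinear.Build k (M j) (M n) *:%R (@lact _ _ M i j n e x)
    (@lact_linearr _ _ M i j n e x).

HB.instance Definition _ i j n (e : i + j = n) (z : M i) :=
  GRing.isLinear.Build k (B j) (M n) *:%R (@ract _ _ M i j n e z)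
    (@ract_linearr _ _ M i j n e z).

HB.instance Definition _ m n (e : m + 1 = n) :=
  GRing.isLinear.Build k (M n) (M m) *:%R (@bdiff _ _ M m n e)
    (@bdiff_linear _ _ M m n e).

Lemma lact0l i j n (e : i + j = n) (z : M j) : lact e (0 : A i) z = 0.
Proof. exact: linear_fun0 (lact_linearl e z). Qed.

Lemma lactDl i j n (e : i + j = n) (x x' : A i) (z : M j) :
  lact e (x + x') z = lact e x z + lact e x' z.
Proof. by have := lact_linearl e z 1 x x'; rewrite !scale1r. Qed.

Lemma lactZl i j n (e : i + j = n) c (x : A i) (z : M j) :
  lact e (c *: x) z = c *: lact e x z.
Proof. by have := lact_linearl e z c x 0; rewrite !addr0 lact0l addr0. Qed.

Lemma ract0l i j n (e : i + j = n) (y : B j) : ract e (0 : M i) y = 0.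
Proof. exact: linear_fun0 (ract_linearl e y). Qed.

Lemma ractDl i j n (e : i + j = n) (z z' : M i) (y : B j) :
  ract e (z + z') y = ract e z y + ract e z' y.
Proof. by have := ract_linearl e y 1 z z'; rewrite !scale1r. Qed.

Lemma ractZl i j n (e : i + j = n) c (z : M i) (y : B j) :
  ract e (c *: z) y = c *: ract e z y.
Proof. by have := ract_linearl e y c z 0; rewrite !addr0 ract0l addr0. Qed.

Lemma ractNl i j n (e : i + j = n) (z : M i) (y : B j) :
  ract e (- z) y = - ract e z y.
Proof. by rewrite -!scaleN1r ractZl. Qed.

End BimodTheory.

Section GlueAlg.
Variables (A B : dgAlg k) (M : bimod A B) (sigma : M (- 1)).
Hypothesis bdiff_sigma : forall m (e : m + 1 = - 1), bdiff e sigma = 0.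
Implicit Types i j l m n : int.

(** Upper triangular matrices with diagonal in [A] and [B] and corner in [M].
    The matrix with [sigma] in the corner squares to zero and is closed, so its
    graded commutator can be added to the entrywise differential. *)
Definition glue_gr n : lmodType k := (A n * M n * B n)%type.

Definition glue_mul i j n (e : i + j = n) (u : glue_gr i) (v : glue_gr j) :
    glue_gr n :=
  (dg_mul e u.1.1 v.1.1, lact e u.1.1 v.1.2 + ract e u.1.2 v.2,
   dg_mul e u.2 v.2).

(** [sigma] has degree [-1], so multiplication by it has the index equations of
    a differential. *)
Fact glue_idxl m n : m + 1 = n -> - 1 + n = m. Proof. by move<-;
  rewrite addrC addrK. Qed.
Fact glue_idxr m n : m + 1 = n -> n - 1 = m. Proof. by move<-; rewrite addrK. Qed.

Definition glue_diff m n (e : m + 1 = n) (u : glue_gr n) : glue_gr m :=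
  (dg_diff e u.1.1,
   bdiff e u.1.2 + ract (glue_idxl e) sigma u.2 - sg k n *: lact
     (glue_idxr e) u.1.1 sigma,
   dg_diff e u.2).

Definition glue : dgAlg k.
Proof.
refine (@DGAlg k glue_gr (dg_one A, 0, dg_one B) glue_mul glue_diff
  _ _ _ _ _ _ _ _).
- move=> i j n e v c u u'; congr (_, _, _) => /=.
  + exact: dg_mul_linearl.
  + rewrite lactDl lactZl ractDl ractZl scalerDr; zmodule.
  + exact: dg_mul_linearl.
- move=> i j n e u c v v'; congr (_, _, _) => /=.
  + exact: dg_mul_linearr.
  + rewrite !linearP /= scalerDr; zmodule.
  + exact: dg_mul_linearr.
- move=> i j l ij jl n eij ejl e e' u v w; congr (_, _, _) => /=.
  + exact: dg_mulA.
  + by rewrite linearD /= (lactA _ _ _ e') (lractA eij _ _ e')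
      (ractA eij _ _ e') ractDl addrA.
  + exact: dg_mulA.
- move=> n e [[x z] y]; congr (_, _, _) => /=.
  + exact: dg_mul1l.
  + by rewrite lact1 ract0l addr0.
  + exact: dg_mul1l.
- move=> n e [[x z] y]; congr (_, _, _) => /=.
  + exact: dg_mul1r.
  + by rewrite ract1 linear0 add0r.
  + exact: dg_mul1r.
- move=> m n e c u v; congr (_, _, _) => /=.
  + exact: dg_diff_linear.
  + rewrite !linearP /= lactDl lactZl !scalerDr !scalerN !scalerA.
    rewrite [c * sg k n]mulrC; zmodule.
  + exact: dg_diff_linear.
- move=> l m n e e' u; congr (_, _, _) => /=.
  + exact: dg_diff_diff.
  + rewrite linearB linearD linearZ /= bdiff_bdiff.
    have e1 : - 1 - 1 + n = l by lia.
    have e2 : n + (- 1 - 1) = l by lia.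
    rewrite (ract_leibniz (glue_idxl e) e' (subrK _ _) e e1 (glue_idxl e')).
    rewrite (lact_leibniz (glue_idxr e) e' e (subrK _ _) (glue_idxr e') e2).
    rewrite !bdiff_sigma ract0l linear0 scaler0 addr0 !add0r sgN sg1.
    rewrite (sgS k e) scaleN1r; zmodule.
  + exact: dg_diff_diff.
- move=> i i' j j' n n' e en ei ej e1 e2 u v; congr (_, _, _) => /=.
  + exact: dg_diff_mul.
  + rewrite linearD /= (lact_leibniz e en ei ej e1 e2).
    rewrite (ract_leibniz e en ei ej e1 e2) !linearB !linearD /= ractDl ractDl
      ractNl.
    rewrite linearZ ractZl /=.
    rewrite (ractA (glue_idxl ei) e (glue_idxl en) e1).
    rewrite -(lactA e (glue_idxr ej) e2 (glue_idxr en)).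
    rewrite -(lractA (glue_idxr ei) (glue_idxl ej) e2 e1).
    rewrite -e sgD -[(-1) ^+ _]/(sg k i).
    rewrite [lact e2 _ (_ *: _)]linearZ /= !scalerN !scalerA; zmodule.
  + exact: dg_diff_mul.
Defined.

Definition glue_fst : dgHom glue A.
Proof. by refine (@DGHom k glue A (fun n u => u.1.1) _ _ _ _). Defined.

Definition glue_snd : dgHom glue B.
Proof. by refine (@DGHom k glue B (fun n u => u.2) _ _ _ _). Defined.

End GlueAlg.
End Glue.

(** * Bimodules given by algebra maps, and products *)

Section Regular.
Variables (k : comPzRingType) (A B D : dgAlg k) (f : dgHom A D) (g : dgHom B D).
Variable c : int.
Hypothesis oddc : sg k c = -1.
Implicit Types i j l m n : int.

Fact shift_idxl i j n : i + j = n -> i + (j + c) = n + c. Proof. by move<-;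
  rewrite addrA. Qed.
Fact shift_idxr i j n : i + j = n -> i + c + j = n + c. Proof. by move<-;
  rewrite addrAC. Qed.

Lemma sgc n : sg k (n + c) = - sg k n.
Proof. by rewrite sgD oddc mulrN1. Qed.

(** The algebra [D] shifted by [c], acted upon through [f] and [g].  The shift is
    odd, whence the sign of the left action and of the differential.  It is used
    with [c = 1] for path algebras and with [c = -1] for derivations. *)
Definition reg : bimod A B.
Proof.
refine (@Bimod k A B (fun n => D (n + c))
  (fun i j n e x z => sg k i *: dg_mul (shift_idxl e) (f _ x) z)
  (fun i j n e z y => dg_mul (shift_idxr e) z (g _ y))
  (fun m n e z => - dg_diff (shift_idxr e) z) _ _ _ _ _ _ _ _ _ _ _ _ _).
- move=> i j n e z a x x'; rewrite linearP dmulDl dmulZl scalerDr !scalerA.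
  by rewrite [a * _]mulrC.
- move=> i j n e x a z z'; rewrite linearP scalerDr !scalerA.
  by rewrite [a * _]mulrC.
- by move=> i j n e y a z z'; rewrite dmulDl dmulZl.
- by move=> i j n e z a y y'; rewrite !linearP.
- by move=> m n e a z z'; rewrite linearP opprD scalerN.
- move=> i j l ij jl n eij ejl e e' x x' z.
  rewrite linearZ /= (dg_mulA eij _ _ (shift_idxl e')) dg_fun_mul scalerA.
  by rewrite -sgD eij.
- move=> i j l ij jl n eij ejl e e' x z y.
  by rewrite dmulZl (dg_mulA (shift_idxl eij) _ _ (shift_idxr e')).
- move=> i j l ij jl n eij ejl e e' z y y'.
  by rewrite dg_fun_mul (dg_mulA (shift_idxr eij) _ _ (shift_idxr e')).
- by move=> n e z; rewrite sg0 scale1r dg_fun_one dg_mul1l.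
- by move=> n e z; rewrite dg_fun_one; exact: dg_mul1r.
- by move=> l m n e e' z; rewrite linearN /= dg_diff_diff !oppr0.
- move=> i i' j j' n n' e en ei ej e1 e2 x z; rewrite linearZ /=.
  rewrite (dg_diff_mul (shift_idxl e) _ ei (shift_idxr ej) (shift_idxl e1)
    (shift_idxl e2)) dg_fun_diff.
  by rewrite linearN /= (sgS k ei) scaleNr; zmodule.
- move=> i i' j j' n n' e en ei ej e1 e2 z y.
  rewrite (dg_diff_mul (shift_idxr e) _ (shift_idxr ei) ej (shift_idxr e1)
    (shift_idxr e2)) dg_fun_diff.
  by rewrite dmulNl sgc scaleNr; zmodule.
Defined.

End Regular.

Section ZeroDiff.
Variables (k : comPzRingType) (B : dgAlg k).

(** A map from a free algebra that does not send generators to cycles is a map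
    of graded algebras only; forgetting the differential of the target makes it
    a map of dg algebras, to which [pres_lift] applies. *)
Definition zero_diff : dgAlg k.
Proof.
refine (@DGAlg k B (dg_one B) (@dg_mul k B) (fun m n _ _ => 0)
  (@dg_mul_linearl k B) (@dg_mul_linearr k B) (@dg_mulA k B)
  (@dg_mul1l k B) (@dg_mul1r k B) _ _ _).
- by move=> m n _ c x y; rewrite scaler0 addr0.
- by [].
- by move=> *; rewrite dmul0l linear0 scaler0 addr0.
Defined.

Lemma is_cycle_zero_diff n (x : zero_diff n) : is_cycle x.
Proof. exact/is_cycleP. Qed.

End ZeroDiff.

Section Product.
Variables (k : comPzRingType) (A B : dgAlg k).

Definition prod_alg : dgAlg k.
Proof.
refine (@DGAlg k (fun n => (A n * B n)%type) (dg_one A, dg_one B)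
  (fun i j n e u v => (dg_mul e u.1 v.1, dg_mul e u.2 v.2))
  (fun m n e u => (dg_diff e u.1, dg_diff e u.2)) _ _ _ _ _ _ _ _).
- by move=> i j n e v c u u'; congr (_, _); exact: dg_mul_linearl.
- by move=> i j n e u c v v'; congr (_, _); exact: dg_mul_linearr.
- by move=> *; congr (_, _); exact: dg_mulA.
- by move=> n e [x y]; congr (_, _); exact: dg_mul1l.
- by move=> n e [x y]; congr (_, _); exact: dg_mul1r.
- by move=> m n e c u v; congr (_, _); exact: dg_diff_linear.
- by move=> *; congr (_, _); exact: dg_diff_diff.
- by move=> *; congr (_, _); exact: dg_diff_mul.
Defined.

Definition prod_fst : dgHom prod_alg A.
Proof. by refine (@DGHom k prod_alg A (fun n u => u.1) _ _ _ _). Defined.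

Definition prod_snd : dgHom prod_alg B.
Proof. by refine (@DGHom k prod_alg B (fun n u => u.2) _ _ _ _). Defined.

Definition prod_pair (C : dgAlg k) (f : dgHom C A) (g : dgHom C B) :
  dgHom C prod_alg.
Proof.
refine (@DGHom k C prod_alg (fun n c => (f n c, g n c)) _ _ _ _).
- by move=> n c x y; congr (_, _); exact: dg_fun_linear.
- by congr (_, _); exact: dg_fun_one.
- by move=> *; congr (_, _); exact: dg_fun_mul.
- by move=> *; congr (_, _); exact: dg_fun_diff.
Defined.

End Product.

(** * Semi-free dg algebras *)

Lemma pres_ind (k : comPzRingType) (G : Type) (deg : G -> int)
    (R : forall n, gterm k deg n -> gterm k deg n -> Prop)
    (P : forall n, pres_alg R n -> Prop) :
  (forall g, P _ (pgen R g)) -> (forall n, P n 0) ->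
  (forall n x y, P n x -> P n y -> P n (x + y)) ->
  (forall n c x, P n x -> P n (c *: x)) -> P 0 (dg_one (pres_alg R)) ->
  (forall i j n (e : i + j = n) x y, P i x -> P j y -> P n (dg_mul e x y)) ->
  forall n x, P n x.
Proof.
move=> Pg P0 PD PZ P1 PM n x; have [t ->] := pcls_surj x.
elim: t => {n x} //.
- by move=> n t ht u hu; rewrite pclsD; exact: PD.
- by move=> n c t ht; rewrite pclsZ; exact: PZ.
- move=> i j n e t ht u hu; rewrite -(pres_mulE R e t u); exact: PM.
Qed.

Section SemiFree.
Variables (k : comPzRingType) (G : Type) (deg : G -> int).
Let F := free_alg k deg.
Variable bd : forall g, F (deg g - 1).

(** A derivation of [F] of degree [-1] is an algebra map to matrices with
    [x] in both diagonal places and the derivative of [x] in the corner.  So the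
    universal property of [F] extends [bd] to a derivation. *)
Let oddN1 : sg k (- 1) = -1. Proof. by rewrite sgN sg1. Qed.
Let F2 := reg (dg_id F) (dg_id F) oddN1.
Let bd0 m (e : m + 1 = - 1) : bdiff e (0 : F2 (-1)) = 0.
Proof. exact: linear0. Qed.
Let D := glue bd0.

Let D_cycle n (u : D n) : is_cycle u.
Proof.
apply/is_cycleP => m e; congr (_, _, _).
have bdiff0 : bdiff e (u.1.2 : F2 n) = 0 by exact: oppr0.
by rewrite bdiff0 ract0l linear0 scaler0 subr0 addr0.
Qed.

Let phi : dgHom F D :=
  pres_lift (R := @no_rel k G deg) (B := D)
    (b := fun g => (pgen _ g, bd g, pgen _ g)) (fun g => D_cycle _)
    (fun _ _ _ r => match r with end).

Let phi_gen g : phi _ (pgen _ g) = (pgen _ g, bd g, pgen _ g).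
Proof. exact: pres_liftE. Qed.

Let phi_id n (x : F n) : (phi n x).1.1 = x /\ (phi n x).2 = x.
Proof.
elim/pres_ind: n / x.
- by move=> g; rewrite phi_gen.
- by move=> n; rewrite linear0.
- by move=> n x y [x1 x2] [y1 y2]; rewrite linearD /= x1 x2 y1 y2.
- by move=> n c x [x1 x2]; rewrite linearZ /= x1 x2.
- by rewrite dg_fun_one.
- by move=> i j n e x y [x1 x2] [y1 y2]; rewrite dg_fun_mul /= x1 x2 y1 y2.
Qed.

Definition sf_der n (x : F n) : F (n - 1) := (phi n x).1.2.

Lemma sf_der_gen g : sf_der (pgen _ g) = bd g.
Proof. by rewrite /sf_der phi_gen. Qed.

Lemma sf_der_linear n : linear (@sf_der n).
Proof. by move=> c x y; rewrite /sf_der linearP. Qed.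

Lemma sf_der_one : sf_der (dg_one F) = 0.
Proof. by rewrite /sf_der dg_fun_one. Qed.

Lemma sf_der_mul i j n (e : i + j = n) (e1 : i - 1 + j = n - 1)
    (e2 : i + (j - 1) = n - 1) (x : F i) (y : F j) :
  sf_der (dg_mul e x y) =
    dg_mul e1 (sf_der x) y + sg k i *: dg_mul e2 x (sf_der y).
Proof.
rewrite /sf_der dg_fun_mul.
transitivity (sg k i *: dg_mul e2 (phi i x).1.1 (phi j y).1.2 +
    dg_mul e1 (phi i x).1.2 (phi j y).2).
  by rewrite (eq_irrelevance e1 (shift_idxr (-1) e)) (eq_irrelevance e2
    (shift_idxl (-1) e)).
by rewrite (proj1 (phi_id x)) (proj2 (phi_id y)) [LHS]addrC.
Qed.

HB.instance Definition _ n :=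
  GRing.isLinear.Build k (F n) (F (n - 1)) *:%R (@sf_der n) (@sf_der_linear n).

Hypothesis bd_bd : forall g, sf_der (bd g) = 0.

(** The square of an odd derivation is a derivation, so it is enough to test it
    on generators. *)
Lemma sf_der2 n (x : F n) : sf_der (sf_der x) = 0.
Proof.
elim/pres_ind: n / x.
- by move=> g; rewrite sf_der_gen bd_bd.
- by move=> n; rewrite !linear0.
- by move=> n x y hx hy; rewrite !linearD /= hx hy addr0.
- by move=> n c x hx; rewrite !linearZ /= hx scaler0.
- by rewrite sf_der_one linear0.
- move=> i j n e x y hx hy.
  have e1 : i - 1 + j = n - 1 by lia.
  have e2 : i + (j - 1) = n - 1 by lia.
  have e3 : i - 1 - 1 + j = n - 1 - 1 by lia.
  have e4 : i - 1 + (j - 1) = n - 1 - 1 by lia.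
  have e5 : i + (j - 1 - 1) = n - 1 - 1 by lia.
  rewrite (sf_der_mul e e1 e2) linearD linearZ /=.
  rewrite (sf_der_mul e1 e3 e4) (sf_der_mul e2 e4 e5) hx hy dmul0l linear0.
  by rewrite scaler0 add0r addr0 sgB1 scaleNr addNr.
Qed.

Fact sf_idx (m n : int) : m + 1 = n -> n - 1 = m. Proof. by move<-;
  rewrite addrK. Qed.

Fact sf_idx_sym (m n : int) : m + 1 = n -> m = n - 1. Proof. by move<-;
  rewrite addrK. Qed.

Definition sf_diff m n (e : m + 1 = n) (x : F n) : F m :=
  ecast i (F i) (sf_idx e) (sf_der x).

Lemma sf_diffE n (e : n - 1 + 1 = n) (x : F n) : sf_diff e x = sf_der x.
Proof. by rewrite /sf_diff (eq_irrelevance (sf_idx e) erefl). Qed.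

Definition semifree : dgAlg k.
Proof.
refine (@DGAlg k F (dg_one F) (@dg_mul k F) sf_diff
  (@dg_mul_linearl k F) (@dg_mul_linearr k F) (@dg_mulA k F)
  (@dg_mul1l k F) (@dg_mul1r k F) _ _ _).
- move=> m n e c x y; have E := sf_idx_sym e; subst m.
  by rewrite !sf_diffE linearP.
- move=> l m n e; have E := sf_idx_sym e; subst m => e'.
  by have E := sf_idx_sym e'; subst l => x; rewrite !sf_diffE sf_der2.
- move=> i i' j j' n n' e en ei ej.
  move: (sf_idx_sym en) (sf_idx_sym ei) (sf_idx_sym ej) => E1 E2 E3.
  subst n' i' j' => e1 e2 x y; rewrite !sf_diffE; exact: sf_der_mul.
Defined.

Definition sf_gen g : semifree (deg g) := pgen (@no_rel k G deg) g.

Lemma sf_gen_diff g (e : deg g - 1 + 1 = deg g) :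
  dg_diff e (sf_gen g) = bd g :> semifree (deg g - 1).
Proof. by rewrite /= sf_diffE sf_der_gen. Qed.

Lemma sf_ind (P : forall n, semifree n -> Prop) :
  (forall g, P _ (sf_gen g)) -> (forall n, P n 0) ->
  (forall n x y, P n x -> P n y -> P n (x + y)) ->
  (forall n c x, P n x -> P n (c *: x)) -> P 0 (dg_one semifree) ->
  (forall i j n (e : i + j = n) x y, P i x -> P j y -> P n (dg_mul e x y)) ->
  forall n x, P n x.
Proof. exact: pres_ind. Qed.

Lemma sf_hom_eq (B : dgAlg k) (f f' : dgHom semifree B) :
  (forall g, f _ (sf_gen g) = f' _ (sf_gen g)) -> f = f'.
Proof.
move=> ff; apply: dgHom_eq => n x; elim/sf_ind: n / x => //.
- by move=> n; rewrite !linear0.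
- by move=> n x y hx hy; rewrite !linearD /= hx hy.
- by move=> n c x hx; rewrite !linearZ /= hx.
- by rewrite !dg_fun_one.
- by move=> i j n e x y hx hy; rewrite !dg_fun_mul hx hy.
Qed.

Section Lift.
Variables (B : dgAlg k) (b : forall g, B (deg g)).

Definition sf_eval : dgHom F (zero_diff B) :=
  pres_lift (R := @no_rel k G deg) (B := zero_diff B) (b := b)
    (fun g => is_cycle_zero_diff _) (fun _ _ _ r => match r with end).

Lemma sf_eval_gen g : sf_eval _ (pgen _ g) = b g.
Proof. exact: pres_liftE. Qed.

Hypothesis b_bd : forall g,
  sf_eval _ (bd g) = dg_diff (subrK 1 (deg g)) (b g).

Lemma sf_lift_exists : exists f : dgHom semifree B,
  forall g, f _ (sf_gen g) = b g.
Proof.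
pose ev n (x : F n) : B n := sf_eval _ x.
have ev0 n : ev n 0 = 0 by exact: (linear0 (sf_eval n)).
have evD n x y : ev n (x + y) = ev n x + ev n y by exact: (linearD (sf_eval n)).
have evZ n c x : ev n (c *: x) = c *: ev n x by exact: (linearZ_LR (sf_eval n) c x).
have dE n (x : F n) : ev _ (sf_der x) = dg_diff (subrK 1 n) (ev _ x).
  elim/pres_ind: n / x.
  - move=> g; rewrite sf_der_gen /ev b_bd; congr (dg_diff _ _).
    by rewrite sf_eval_gen.
  - by move=> n; rewrite linear0 !ev0 linear0.
  - by move=> n x y hx hy; rewrite linearD !evD hx hy linearD.
  - by move=> n c x hx; rewrite linearZ /= !evZ hx linearZ.
  - rewrite sf_der_one ev0 [ev _ _](dg_fun_one sf_eval).
    by apply: esym; exact: dg_diff_one.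
  - move=> i j n e x y hx hy.
    have e1 : i - 1 + j = n - 1 by lia.
    have e2 : i + (j - 1) = n - 1 by lia.
    have evM i' j' n' (e' : i' + j' = n') x' y' :
      ev n' (dg_mul e' x' y') = dg_mul e' (ev _ x') (ev _ y').
      exact: (dg_fun_mul sf_eval).
    rewrite (sf_der_mul e e1 e2) evD evZ !evM hx hy.
    exact/esym/dg_diff_mul.
unshelve eexists (@DGHom k semifree B (sf_eval) _ _ _ _).
- by move=> n c x y; exact: (dg_fun_linear sf_eval).
- exact: (dg_fun_one sf_eval).
- exact: (dg_fun_mul sf_eval).
- move=> m n e x; have E : m = n - 1 by rewrite -e addrK.
  subst m; rewrite [dg_diff e x]sf_diffE -[LHS]/(ev _ _) dE.
  by congr (dg_diff _ _); exact: eq_irrelevance.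
- exact: sf_eval_gen.
Qed.

End Lift.
End SemiFree.

(** * Quasi-isomorphisms and units in homology *)

Section Homology.
Variable k : comPzRingType.
Implicit Types A B C : dgAlg k.

Lemma cycle0 A n (z : A n) m (e : m + 1 = n) : is_cycle z -> dg_diff e z = 0.
Proof. by move/is_cycleP. Qed.

Lemma is_cycle_diff0 A n (z : A n) m (e : m + 1 = n) :
  dg_diff e z = 0 -> is_cycle z.
Proof.
move=> dz; apply/is_cycleP => m' e'; have E : m' = m by lia.
by subst m'; rewrite (eq_irrelevance e' e).
Qed.

Lemma is_cycle_hom A B (f : dgHom A B) n (z : A n) :
  is_cycle z -> is_cycle (f n z).
Proof. by move=> hz; apply/is_cycleP => m e;
  rewrite -dg_fun_diff cycle0 ?linear0. Qed.

Lemma hmap_inj A B (f : dgHom A B) n : injective (@hmap k A B f n) ->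
  forall z : A n, is_cycle z -> forall b : B (n + 1),
  f n z = dg_diff erefl b -> exists a : A (n + 1), dg_diff erefl a = z.
Proof.
move=> finj z hz b fz.
have : hmap f (hclass (Cycles hz)) = hmap f (hclass 0).
  by rewrite !hmapE; apply/hclassP; exists b; rewrite /= -fz linear0 subr0.
by move/finj/hclassP => [a /=]; rewrite subr0; exists a.
Qed.

(** The two halves are injectivity and surjectivity on homology, in terms of
    elements. *)
Lemma quasi_isoP A B (f : dgHom A B) :
  @quasi_iso k A B f <->
  (forall n (z : A n), is_cycle z -> forall b : B (n + 1),
    f n z = dg_diff erefl b -> exists a : A (n + 1), dg_diff erefl a = z) /\
  (forall n (y : B n), is_cycle y -> exists2 z : A n, is_cycle z &
    exists b : B (n + 1), f n z - y = dg_diff erefl b).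
Proof.
split=> [qf|[finj fsurj] n].
  split=> n y hy; first exact: (hmap_inj (bij_inj (qf n))).
  have [g _ gK] := qf n.
  have [z ez] := hclass_surj (g (hclass (Cycles hy))).
  exists (val z); first exact: (valP z).
  have := gK (hclass (Cycles hy)); rewrite ez hmapE => /hclassP [b eb].
  by exists b; rewrite eb.
have surj (y : homology B n) : exists x, hmap f x = y.
  have [w ->] := hclass_surj y.
  have [z hz [b fz]] := fsurj n (val w) (valP w).
  exists (hclass (Cycles hz)); rewrite hmapE; apply/hclassP.
  by exists b; rewrite fz.
pose g y := sval (cid (surj y)).
have gK : cancel g (@hmap k A B f n) by move=> y; rewrite /g; case: cid.
apply: (Bijective _ gK) => x; move: (gK (hmap f x)); move: (g _) => x'.
have [z ->] := hclass_surj x; have [z' ->] := hclass_surj x'.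
rewrite !hmapE => /hclassP [b eb]; apply/hclassP.
have hz : is_cycle (val z' - val z) by exact: (valP (z' - z)).
by apply: (finj _ _ hz b); rewrite eb linearB.
Qed.

Lemma quasi_iso_cancel A B C (g : dgHom B C) (f : dgHom A B) :
  @quasi_iso k B C g ->
  @quasi_iso k A C (dg_comp g f) ->
  @quasi_iso k A B f.
Proof.
move=> /quasi_isoP [ginj gsurj] /quasi_isoP [gfinj gfsurj].
apply/quasi_isoP; split=> [n z hz b fz|n y hy].
  apply: (gfinj n z hz (g _ b)); by rewrite /= fz dg_fun_diff.
have [z hz [c gfz]] := gfsurj n (g n y) (is_cycle_hom g hy).
exists z => //.
have hfzy : is_cycle (f n z - y).
  exact: (valP (Cycles (is_cycle_hom f hz) - Cycles hy)).
have [b db] : exists b : B (n + 1), dg_diff erefl b = f n z - y.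
  by apply: (ginj _ _ hfzy c); rewrite linearB.
by exists b.
Qed.

Fact idx01 : 0 + 1 = 1 :> int. Proof. by []. Qed.

(** The chain-level form of [hinvertible], see [hinvertibleP]. *)
Definition hunit A p (s : A p) : Prop := exists (t : A (- p)) (h0 h1 : A 1),
  [/\ is_cycle t,
      dg_diff idx01 h0 = dg_mul (subrr p) s t - dg_one A
    & dg_diff idx01 h1 = dg_mul (addNr p) t s - dg_one A].

Lemma hunit_hom A B (f : dgHom A B) p (s : A p) : hunit s -> hunit (f p s).
Proof.
move=> [t [h0 [h1 [ht e0 e1]]]]; exists (f _ t), (f _ h0), (f _ h1).
split; first exact: is_cycle_hom.
  by rewrite -dg_fun_diff e0 linearB /= dg_fun_mul dg_fun_one.
by rewrite -dg_fun_diff e1 linearB /= dg_fun_mul dg_fun_one.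
Qed.

Lemma hinvertibleP A p (s : A p) (hs : is_cycle s) :
  hinvertible (hclass (Cycles hs)) <-> hunit s.
Proof.
split=> [[y]|[t [h0 [h1 [ht e0 e1]]]]].
  have [t ->] := hclass_surj y.
  rewrite !hmulE /hone => -[/hclassP [h0 e0] /hclassP [h1 e1]].
  by exists (val t), h0, h1; split; [exact: (valP t)|..];
    rewrite (eq_irrelevance idx01 erefl).
exists (hclass (Cycles ht)); rewrite !hmulE.
by split; apply/hclassP; [exists h0|exists h1];
  rewrite (eq_irrelevance erefl idx01).
Qed.

(** Acyclicity of the cone of left multiplication by [s] on the kernel of [f]:
    the pair [(a, b)] is a cycle of the cone and [(i, j)] bounds it, up to the
    signs of the shifts.  It is what lifting a homotopy inverse of [s]
    along a surjective [f] requires. *)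
Definition cone_acyclic (E B : dgAlg k) (f : dgHom E B) p (s : E p) : Prop :=
  forall (n n1 m m1 m' : int) (en : n + 1 = n1) (em : m + 1 = m1)
    (e1 : p + n1 = m) (e2 : m' + 1 = m) (e3 : p + n = m')
    (a : E n) (b : E m), f n a = 0 -> f m b = 0 -> is_cycle a ->
  dg_diff e2 b = sg k p *: dg_mul e3 s a ->
  exists (i : E n1) (j : E m1),
    [/\ f _ i = 0, f _ j = 0, dg_diff en i = a
      & b = dg_mul e1 s i + dg_diff em j].

(** Left multiplication by a homotopy inverse [t] inverts that by [s] up to the
    homotopies [h0] and [h1], and all of these preserve the kernel of [f]. *)
Lemma hunit_cone_acyclic (E B : dgAlg k) (f : dgHom E B) p (s : E p) :
  is_cycle s -> hunit s -> cone_acyclic f s.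
Proof.
move=> hs [t [h0 [h1 [ht d0 d1]]]] n n1 m m1 m' en em.
case: n1 / en; case: m1 / em => e1 e2 e3 a b fa fb ha db.
have e4 : - p + m = n + 1 by lia.
have e5 : 1 + n = n + 1 by lia.
have e6 : 1 + m = m + 1 by lia.
have e7 : - p + m' = n by lia.
have e8 : - p - 1 + m = n by lia.
have e9 : 1 + (n - 1) = n by lia.
have e10 : p - 1 + (n + 1) = m' by lia.
have dtb (x : E m) (e : m' + 1 = m) : dg_diff erefl (dg_mul e4 t x) =
    sg k p *: dg_mul e7 t (dg_diff e x).
  by rewrite (dg_diff_mul e4 _ (subrK _ _) e e8 e7) (cycle0 _ ht) dmul0l add0r sgN.
have dha : dg_diff erefl (dg_mul e5 h1 a) =
    dg_mul (add0r n) (dg_mul (addNr p) t s) a - a.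
  rewrite (dg_diff_mul e5 _ idx01 (subrK _ _) (add0r n) e9) (cycle0 _ ha) linear0.
  by rewrite scaler0 addr0 d1 dmulBl dg_mul1l.
(* [t] undoes the multiplication by [s] up to [h1]: this bounds [a].  What is
   then left of [b] is a cycle, which [t] and [h0] treat in the same way. *)
pose i0 := dg_mul e4 t b - dg_mul e5 h1 a.
have di0 : dg_diff erefl i0 = a.
  rewrite linearB /= (dtb _ e2) dha db linearZ /= sgZK.
  by rewrite (dg_mulA (addNr p) _ _ (add0r n)); zmodule.
pose b' := b - dg_mul e1 s i0.
have hb' : dg_diff e2 b' = 0.
  rewrite linearB /= db (dg_diff_mul e1 _ (subrK _ _) erefl e10 e3).
  by rewrite (cycle0 _ hs) dmul0l add0r di0 subrr.
exists (i0 + dg_mul e4 t b'), (- dg_mul e6 h0 b').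
have fi0 : f _ i0 = 0 by rewrite linearB /= !dg_fun_mul fa fb !linear0 addr0.
have fb' : f _ b' = 0 by rewrite linearB /= !dg_fun_mul fi0 fb !linear0 addr0.
split.
- by rewrite linearD /= fi0 dg_fun_mul fb' linear0 addr0.
- by rewrite linearN /= dg_fun_mul fb' linear0 oppr0.
- by rewrite linearD /= di0 (dtb _ e2) hb' linear0 scaler0 addr0.
- rewrite linearN linearD /=.
  have e11 : 1 + m' = m by lia.
  rewrite (dg_diff_mul e6 _ idx01 e2 (add0r m) e11) hb' linear0 scaler0 addr0 d0.
  rewrite dmulBl dg_mul1l (dg_mulA (subrr p) _ _ (add0r m)) {3}/b'; zmodule.
Qed.

End Homology.

(** * Adjoining contractible pairs and homotopy inverses *)

(** Both sides are [sts - s]; this makes the boundary of the generator [u]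
    closed. *)
Lemma dmul_sandwich (k : comPzRingType) (A : dgAlg k) p (s : A p)
    (t : A (- p)) n (e2 : p + 0 = n) (e3 : 0 + p = n) :
  dg_mul e2 s (dg_mul (addNr p) t s - dg_one A) =
  dg_mul e3 (dg_mul (subrr p) s t - dg_one A) s.
Proof.
rewrite linearB dmulBl /= (dg_mulA (subrr p) _ _ e3).
have E : p = n by lia.
by case: n / E e2 e3 => e2 e3; rewrite dg_mul1r dg_mul1l.
Qed.

(** Degrees of boundaries come as [p + 1 + 1 - 1] from the generators and as
    [p + 1] in use. *)
Lemma diff_coh_idx (k : comPzRingType) (A : dgAlg k) p (s : A p) (h h' : A 1)
    (u : A (p + 1 + 1)) n (e : n + 1 = p + 1 + 1) (e1 : p + 1 = n)
    (e2 : 1 + p = n) :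
  dg_diff e u = dg_mul e1 s h - sg k p *: dg_mul e2 h' s <->
  dg_diff erefl u =
    dg_mul erefl s h - sg k p *: dg_mul (addrC 1 p) h' s.
Proof.
case: n / e1 e e2 => e e2.
by rewrite (eq_irrelevance e erefl) (eq_irrelevance e2 (addrC 1 p)).
Qed.

Section Resolutions.
Variables (k : comPzRingType) (G : Type) (deg : G -> int) (Q C : dgAlg k).

(** Besides [S], a pair [x], [dx] for each element of [Q]: sending [x] to that
    element makes a map to [Q] surjective, and the pairs carry no homology. *)
Inductive base_index :=
| GenS of G
| GenDisk n of Q n
| GenDiskBd n of Q n.

Definition base_deg x := match x with
  | GenS g => deg g
  | GenDisk n _ => n
  | GenDiskBd n _ => n - 1
  end.

Definition base_bd x : free_alg k base_deg (base_deg x - 1) := match x with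
  | GenS g => 0
  | @GenDisk n a => pgen (@no_rel k _ base_deg) (GenDiskBd a)
  | GenDiskBd n a => 0
  end.

Lemma base_bd_bd x : sf_der base_bd (base_bd x) = 0.
Proof.
case: x => [g|n a|n a]; try exact: (linear0 (sf_der base_bd (n := _))).
exact: (sf_der_gen base_bd (GenDiskBd a)).
Qed.

Definition base_alg := semifree base_bd_bd.
Definition base_gen x : base_alg (base_deg x) := sf_gen base_bd_bd x.

Lemma base_gen_S g : is_cycle (base_gen (GenS g)).
Proof. by apply/eqP; rewrite /base_gen sf_gen_diff. Qed.

Lemma base_gen_disk n (a : Q n) (e : n - 1 + 1 = n) :
  dg_diff e (base_gen (GenDisk a)) = base_gen (GenDiskBd a).
Proof. by rewrite /base_gen [LHS](@sf_gen_diff _ _ _ _ _ (GenDisk a)). Qed.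

Lemma base_gen_disk_bd n (a : Q n) : is_cycle (base_gen (GenDiskBd a)).
Proof. by apply/eqP; rewrite /base_gen sf_gen_diff. Qed.

Lemma base_alg_map (E : dgAlg k) (s : forall g, E (deg g))
    (x : forall n, Q n -> E n) : (forall g, is_cycle (s g)) ->
  exists u : dgHom base_alg E, (forall g, u _ (base_gen (GenS g)) = s g) /\
    (forall n (a : Q n), u _ (base_gen (GenDisk a)) = x n a).
Proof.
move=> hs.
pose b y : E (base_deg y) := match y with
  | GenS g => s g
  | @GenDisk n a => x n a
  | @GenDiskBd n a => dg_diff (subrK 1 n) (x n a)
  end.
have ev0 n : sf_eval b n 0 = 0 by exact: linear0.
have [|u hu] := @sf_lift_exists _ _ _ _ base_bd_bd E b.
  case=> [g|n a|n a].
  - by rewrite [LHS]ev0; apply: esym; exact: (cycle0 (subrK 1 (deg g)) (hs g)).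
  - exact: (sf_eval_gen b (GenDiskBd a)).
  - by rewrite [LHS]ev0; apply: esym;
      exact: (dg_diff_diff (subrK 1 n) (subrK 1 (n - 1)) (x n a)).
by exists u; split=> [g|n a]; rewrite /base_gen hu.
Qed.

Lemma base_alg_hom_eq (E : dgAlg k) (u v : dgHom base_alg E) :
  (forall g, u _ (base_gen (GenS g)) = v _ (base_gen (GenS g))) ->
  (forall n (a : Q n), u _ (base_gen (GenDisk a)) = v _ (base_gen
    (GenDisk a))) -> u = v.
Proof.
move=> uvS uvX; apply: sf_hom_eq => -[g|n a|n a].
- exact: uvS.
- exact: uvX.
- rewrite -[sf_gen _ _]/(base_gen (GenDiskBd a)) -(base_gen_disk _ (subrK 1 n)).
  by rewrite !dg_fun_diff uvX.
Qed.

(** The pairs lift freely along a surjection, so that only the choice of the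
    images of the [s] matters. *)
Lemma base_alg_lifting (E B : dgAlg k) (f : dgHom E B) (b : dgHom base_alg B)
    (s : forall g, E (deg g)) :
  (forall n (y : B n), exists x, f n x = y) -> (forall g, is_cycle (s g)) ->
  (forall g, f _ (s g) = b _ (base_gen (GenS g))) ->
  exists u : dgHom base_alg E,
    dg_comp f u = b /\ forall g, u _ (base_gen (GenS g)) = s g.
Proof.
move=> fsurj hs fs.
pose x n (a : Q n) : E n := sval (cid (fsurj _ (b _ (base_gen (GenDisk a))))).
have fx n (a : Q n) : f _ (x n a) = b _ (base_gen (GenDisk a)) by rewrite /x;
    case: cid.
have [u [us ux]] := base_alg_map x hs.
exists u; split=> //; apply: base_alg_hom_eq => [g|n a] /=.
  by rewrite us fs.
by rewrite ux fx.
Qed.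

(** For each [s], the generators [GenInv], [GenRight], [GenLeft] and [GenCoh] are
    [t], [h'], [h] and [u] with [dh' = st - 1], [dh = ts - 1] and
    [du = sh - (-1)^|s| h's]; the last pair of constructors is a contractible
    pair for each element of [C]. *)
Inductive hinv_index :=
| GenBase of base_index
| GenInv of G
| GenRight of G
| GenLeft of G
| GenCoh of G
| GenDisk2 n of C n
| GenDisk2Bd n of C n.

Definition hinv_deg y := match y with
  | GenBase x => base_deg x
  | GenInv g => - deg g
  | GenRight g => 1
  | GenLeft g => 1
  | GenCoh g => deg g + 1 + 1
  | GenDisk2 n _ => n
  | GenDisk2Bd n _ => n - 1
  end.

Let CA := free_alg k hinv_deg.
Let cg y : CA (hinv_deg y) := pgen (@no_rel k _ hinv_deg) y.

Definition hinv_bd y : CA (hinv_deg y - 1) := match y with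
  | GenBase (GenS g) => 0
  | GenBase (@GenDisk n a) => cg (GenBase (GenDiskBd a))
  | GenBase (GenDiskBd n a) => 0
  | GenInv g => 0
  | GenRight g => dg_mul (subrr (deg g)) (cg (GenBase (GenS g))) (cg
    (GenInv g)) - dg_one CA
  | GenLeft g => dg_mul (addNr (deg g)) (cg (GenInv g)) (cg (GenBase
    (GenS g))) - dg_one CA
  | GenCoh g => dg_mul (esym (addrK 1 (deg g + 1))) (cg (GenBase (GenS g))) (cg
    (GenLeft g))
     - sg k (deg g) *:
      dg_mul (etrans (addrC 1 (deg g)) (esym (addrK 1 (deg g + 1))))
        (cg (GenRight g)) (cg (GenBase (GenS g)))
  | @GenDisk2 n a => cg (GenDisk2Bd a)
  | GenDisk2Bd n a => 0
  end.

Lemma hinv_bd_bd y : sf_der hinv_bd (hinv_bd y) = 0.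
Proof.
have d0 n : sf_der hinv_bd (0 : CA n) = 0 by exact: linear0.
have dS g : sf_der hinv_bd (cg (GenBase (GenS g))) = 0 by exact: sf_der_gen.
have dT g : sf_der hinv_bd (cg (GenInv g)) = 0 by exact: sf_der_gen.
have dH' g : sf_der hinv_bd (cg (GenRight g)) = hinv_bd
    (GenRight g) by exact: sf_der_gen.
have dH g : sf_der hinv_bd (cg (GenLeft g)) = hinv_bd
    (GenLeft g) by exact: sf_der_gen.
case: y => [[g|n a|n a]|g|g|g|g|n a|n a]; try exact: d0.
- exact: (sf_der_gen hinv_bd (GenBase (GenDiskBd a))).
- have e1 : deg g - 1 + - deg g = 0 - 1 by lia.
  have e2 : deg g + (- deg g - 1) = 0 - 1 by lia.
  have h : sf_der hinv_bd (dg_mul (subrr (deg g)) (cg (GenBase (GenS g))) (cg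
      (GenInv g))) = 0.
    by rewrite (sf_der_mul hinv_bd _ e1 e2) dS dT dmul0l linear0 scaler0 addr0.
  rewrite linearB; apply: etrans (subr0 0).
  exact: (congr2 (fun x y => x - y) h (sf_der_one hinv_bd)).
- have e1 : - deg g - 1 + deg g = 0 - 1 by lia.
  have e2 : - deg g + (deg g - 1) = 0 - 1 by lia.
  have h : sf_der hinv_bd (dg_mul (addNr (deg g)) (cg (GenInv g)) (cg (GenBase
      (GenS g)))) = 0.
    by rewrite (sf_der_mul hinv_bd _ e1 e2) dS dT dmul0l linear0 scaler0 addr0.
  rewrite linearB; apply: etrans (subr0 0).
  exact: (congr2 (fun x y => x - y) h (sf_der_one hinv_bd)).
- have e1 : deg g - 1 + 1 = deg g + 1 + 1 - 1 - 1 by lia.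
  have e2 : deg g + (1 - 1) = deg g + 1 + 1 - 1 - 1 by lia.
  have e3 : 1 - 1 + deg g = deg g + 1 + 1 - 1 - 1 by lia.
  have e4 : 1 + (deg g - 1) = deg g + 1 + 1 - 1 - 1 by lia.
  rewrite linearB linearZ /= (sf_der_mul hinv_bd _ e1 e2)
    (sf_der_mul hinv_bd _ e3 e4).
  rewrite !dS dmul0l linear0 scaler0 add0r addr0 dH dH' -scalerBr.
  rewrite [X in _ *: (X - _)](dmul_sandwich _ _ e2 e3).
  by rewrite subrr scaler0.
- exact: (sf_der_gen hinv_bd (GenDisk2Bd a)).
Qed.

Definition hinv_alg := semifree hinv_bd_bd.
Definition hinv_gen y : hinv_alg (hinv_deg y) := sf_gen hinv_bd_bd y.

Lemma hinv_gen_S g : is_cycle (hinv_gen (GenBase (GenS g))).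
Proof. by apply/eqP; exact: (sf_gen_diff hinv_bd_bd (g := GenBase (GenS g))). Qed.

Lemma hinv_gen_base_disk n (a : Q n) (e : n - 1 + 1 = n) :
  dg_diff e (hinv_gen (GenBase (GenDisk a))) = hinv_gen (GenBase (GenDiskBd a)).
Proof. exact: (sf_gen_diff hinv_bd_bd (g := GenBase (GenDisk a))). Qed.

Lemma hinv_gen_inv g : is_cycle (hinv_gen (GenInv g)).
Proof. by apply/eqP; exact: (sf_gen_diff hinv_bd_bd (g := GenInv g)). Qed.

Lemma hinv_gen_right g : dg_diff idx01 (hinv_gen (GenRight g)) =
  dg_mul (subrr (deg g)) (hinv_gen (GenBase (GenS g))) (hinv_gen
    (GenInv g)) - dg_one hinv_alg.
Proof. exact: (sf_gen_diff hinv_bd_bd (g := GenRight g)). Qed.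

Lemma hinv_gen_left g : dg_diff idx01 (hinv_gen (GenLeft g)) =
  dg_mul (addNr (deg g)) (hinv_gen (GenInv g)) (hinv_gen (GenBase
    (GenS g))) - dg_one hinv_alg.
Proof. exact: (sf_gen_diff hinv_bd_bd (g := GenLeft g)). Qed.

Lemma hinv_gen_coh g : dg_diff erefl (hinv_gen (GenCoh g)) =
  dg_mul erefl (hinv_gen (GenBase (GenS g))) (hinv_gen (GenLeft g)) -
    sg k (deg g) *: dg_mul (addrC 1 (deg g)) (hinv_gen (GenRight g)) (hinv_gen
      (GenBase (GenS g))).
Proof.
have e : deg g + 1 + 1 - 1 + 1 = deg g + 1 + 1 by lia.
have /diff_coh_idx := sf_gen_diff hinv_bd_bd (g := GenCoh g) e; exact.
Qed.

(** The values that a map from [hinv_alg] takes on the generators [t], [h'], [h]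
    and [u] attached to one [s]. *)
Definition inverse_data (E : dgAlg k) p (s : E p) (t : E (- p)) (h' h : E 1)
    (u : E (p + 1 + 1)) : Prop :=
  [/\ is_cycle t,
      dg_diff idx01 h' = dg_mul (subrr p) s t - dg_one E,
      dg_diff idx01 h = dg_mul (addNr p) t s - dg_one E
    & dg_diff erefl u =
        dg_mul erefl s h - sg k p *: dg_mul (addrC 1 p) h' s].

Lemma hinv_alg_map (E : dgAlg k) (x : forall y : base_index, E (base_deg y))
    (t : forall g, E (- deg g)) (h' h : G -> E 1)
    (u : forall g, E (deg g + 1 + 1)) (y : forall n, C n -> E n) :
  (forall g, is_cycle (x (GenS g))) ->
  (forall n (a : Q n), dg_diff (subrK 1 n) (x (GenDisk a)) = x (GenDiskBd a)) ->
  (forall n (a : Q n), is_cycle (x (GenDiskBd a))) ->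
  (forall g, inverse_data (x (GenS g)) (t g) (h' g) (h g) (u g)) ->
  exists f : dgHom hinv_alg E, [/\ forall z, f _ (hinv_gen (GenBase z)) = x z,
    forall g, f _ (hinv_gen (GenInv g)) = t g, forall g, f _ (hinv_gen
      (GenRight g)) = h' g,
    forall g, f _ (hinv_gen (GenLeft g)) = h g
  & [/\ forall g, f _ (hinv_gen (GenCoh g)) = u g
      & forall n (c : C n), f _ (hinv_gen (GenDisk2 c)) = y n c]].
Proof.
move=> xS xX xDX inv.
pose b z : E (hinv_deg z) := match z with
  | GenBase z => x z
  | GenInv g => t g
  | GenRight g => h' g
  | GenLeft g => h g
  | GenCoh g => u g
  | @GenDisk2 n c => y n c
  | @GenDisk2Bd n c => dg_diff (subrK 1 n) (y n c)
  end.
have ev0 n : sf_eval b n 0 = 0 by exact: linear0.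
have ev1 : sf_eval b 0 (dg_one CA) = dg_one E by exact: (dg_fun_one (sf_eval b)).
have evM i j n (e : i + j = n) v w : sf_eval b n (dg_mul e v w) =
    @dg_mul k E _ _ _ e (sf_eval b _ v) (sf_eval b _ w).
  exact: (dg_fun_mul (sf_eval b)).
have [|f hf] := @sf_lift_exists _ _ _ _ hinv_bd_bd E b.
  case=> [[g|n a|n a]|g|g|g|g|n a|n a].
  - by rewrite [LHS]ev0; apply: esym; exact: (cycle0 (subrK 1 (deg g)) (xS g)).
  - apply: etrans (esym (xX n a)); exact: (sf_eval_gen b (GenBase (GenDiskBd a))).
  - by rewrite [LHS]ev0; apply: esym; exact: (cycle0 (subrK 1 (n - 1)) (xDX n a)).
  - rewrite [LHS]ev0; apply: esym; have [ht _ _ _] := inv g.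
    exact: (cycle0 (subrK 1 (- deg g)) ht).
  - have [_ e _ _] := inv g.
    apply: etrans (etrans (esym e) (congr1 (fun i => @dg_diff k E 0 1 i (h' g))
      (eq_irrelevance idx01 (subrK 1 1)))).
    apply: etrans (linearB (sf_eval b 0) _ _) _.
    exact: (congr2 (fun v w : E 0 => v - w)
      (etrans (evM _ _ _ _ _ _) (congr2 (@dg_mul k E _ _ _ (subrr (deg g)))
        (sf_eval_gen b (GenBase (GenS g))) (sf_eval_gen b (GenInv g)))) ev1).
  - have [_ _ e _] := inv g.
    apply: etrans (etrans (esym e) (congr1 (fun i => @dg_diff k E 0 1 i (h g))
      (eq_irrelevance idx01 (subrK 1 1)))).
    apply: etrans (linearB (sf_eval b 0) _ _) _.
    exact: (congr2 (fun v w : E 0 => v - w)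
      (etrans (evM _ _ _ _ _ _) (congr2 (@dg_mul k E _ _ _ (addNr (deg g)))
         (sf_eval_gen b (GenInv g)) (sf_eval_gen b (GenBase (GenS g))))) ev1).
  - have [_ _ _ e] := inv g.
    pose e1 := esym (addrK 1 (deg g + 1)); pose e2 := etrans (addrC 1 (deg g)) e1.
    have {e} := proj2 (diff_coh_idx _ _ _ _ (subrK 1 _) e1 e2) e.
    move=> e; apply: etrans (esym e).
    apply: etrans (linearB (sf_eval b (deg g + 1 + 1 - 1)) _ _) _.
    apply: (congr2 (fun v w : E _ => v - w)).
      apply: etrans (evM _ _ _ _ _ _) _.
      exact: (congr2 (@dg_mul k E _ _ _ e1)
        (sf_eval_gen b (GenBase (GenS g))) (sf_eval_gen b (GenLeft g))).
    apply: etrans (linearZ_LR (sf_eval b (deg g + 1 + 1 - 1)) _ _) _.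
    congr (_ *: _); apply: etrans (evM _ _ _ _ _ _) _.
    exact: (congr2 (@dg_mul k E _ _ _ e2)
        (sf_eval_gen b (GenRight g)) (sf_eval_gen b (GenBase (GenS g)))).
  - exact: (sf_eval_gen b (GenDisk2Bd a)).
  - by rewrite [LHS]ev0; apply: esym;
      exact: (dg_diff_diff (subrK 1 n) (subrK 1 (n - 1)) (y n a)).
exists f.
by split=> [z|g|g|g|]; last split=> [g|n c]; rewrite /hinv_gen hf.
Qed.

Definition base_to_hinv : dgHom base_alg hinv_alg :=
  sval (cid (base_alg_map (fun n (a : Q n) => hinv_gen (GenBase
    (GenDisk a))) hinv_gen_S)).

Lemma base_to_hinvE x : base_to_hinv _ (base_gen x) = hinv_gen (GenBase x).
Proof.
rewrite /base_to_hinv; case: cid => u /= [uS uX]; case: x => [g|n a|n a].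
- exact: uS.
- exact: uX.
- by rewrite -(base_gen_disk _ (subrK 1 n)) dg_fun_diff uX hinv_gen_base_disk.
Qed.

Lemma hinv_alg_hom_eq (E : dgAlg k) (f f' : dgHom hinv_alg E) :
  dg_comp f base_to_hinv = dg_comp f' base_to_hinv ->
  (forall g, f _ (hinv_gen (GenInv g)) = f' _ (hinv_gen (GenInv g))) ->
  (forall g, f _ (hinv_gen (GenRight g)) = f' _ (hinv_gen (GenRight g))) ->
  (forall g, f _ (hinv_gen (GenLeft g)) = f' _ (hinv_gen (GenLeft g))) ->
  (forall g, f _ (hinv_gen (GenCoh g)) = f' _ (hinv_gen (GenCoh g))) ->
  (forall n (c : C n), f _ (hinv_gen (GenDisk2 c)) = f' _ (hinv_gen
    (GenDisk2 c))) -> f = f'.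
Proof.
move=> fj fT fH' fH fK fY.
apply: sf_hom_eq => -[x|g|g|g|g|n c|n c].
- by rewrite -[sf_gen _ _]/(hinv_gen _) -base_to_hinvE -[LHS]/(dg_comp f
    base_to_hinv _ _) fj.
- exact: fT.
- exact: fH'.
- exact: fH.
- exact: fK.
- exact: fY.
- have -> : sf_gen hinv_bd_bd (GenDisk2Bd c) = dg_diff (subrK 1 n) (hinv_gen
    (GenDisk2 c)).
    exact: (esym (sf_gen_diff hinv_bd_bd (g := GenDisk2 c) _)).
  by rewrite !dg_fun_diff fY.
Qed.

Lemma inverse_data_hom (E B : dgAlg k) (f : dgHom E B) p (s : E p) t h' h u :
  inverse_data s t h' h u ->
  inverse_data (f _ s) (f _ t) (f _ h') (f _ h) (f _ u).
Proof.
case=> ht e1 e2 e3; split; first exact: is_cycle_hom.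
- by rewrite -dg_fun_diff e1 linearB /= dg_fun_mul dg_fun_one.
- by rewrite -dg_fun_diff e2 linearB /= dg_fun_mul dg_fun_one.
- by rewrite -dg_fun_diff e3 linearB linearZ /= !dg_fun_mul.
Qed.

Lemma hinv_gen_inverse_data g : inverse_data (hinv_gen (GenBase (GenS g)))
    (hinv_gen (GenInv g))
  (hinv_gen (GenRight g)) (hinv_gen (GenLeft g)) (hinv_gen (GenCoh g)).
Proof. split; [exact: hinv_gen_inv|exact: hinv_gen_right|exact:
  hinv_gen_left|exact: hinv_gen_coh]. Qed.

(** Arbitrary lifts of [t] and [h'] fail their equations by a cycle of the cone of
    [s] on the kernel, and a chain bounding it is the correction.  Once [t] and
    [h'] are corrected, the same holds for [h] and [u]; this is where the form of
    the boundary of [u] matters. *)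
Lemma inverse_data_lifting (E B : dgAlg k) (f : dgHom E B) p (s : E p)
    (t : B (- p)) (h' h : B 1) (u : B (p + 1 + 1)) :
  (forall n (y : B n), exists x, f n x = y) -> is_cycle s ->
  cone_acyclic f s -> inverse_data (f _ s) t h' h u ->
  exists t1 h1' h1 u1, [/\ inverse_data s t1 h1' h1 u1, f _ t1 = t,
    f _ h1' = h', f _ h1 = h & f _ u1 = u].
Proof.
move=> fsurj hs cone [ht e1 e2 e3].
have [t0 ft0] := fsurj _ t; have [h0' fh0'] := fsurj _ h'.
have e4 : p + (- p - 1) = 0 - 1 by lia.
have e5 : p - 1 + - p = 0 - 1 by lia.
have e6 : p - 1 + 1 = p by lia.
have e8 : 1 + (p - 1) = p by lia.
have [||||i [j [fi fj di bij]]] := cone _ _ _ _ _ (subrK 1 (- p)) idx01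
    (subrr p) (subrK 1 0)
    e4 (dg_diff (subrK 1 (- p)) t0)
    (dg_mul (subrr p) s t0 - dg_one E - dg_diff idx01 h0').
- by rewrite dg_fun_diff ft0 (cycle0 _ ht).
- by rewrite !linearB /= dg_fun_mul dg_fun_one dg_fun_diff ft0 fh0' e1 subrr.
- by apply/is_cycleP => m e; exact: dg_diff_diff.
- rewrite !linearB /= dg_diff_one dg_diff_diff !subr0.
  by rewrite (dg_diff_mul _ _ (subrK 1 p) (subrK 1 (- p)) e5 e4)
    (cycle0 _ hs) dmul0l [LHS]add0r.
pose t1 := t0 - i; pose h1' := h0' + j.
have ft1 : f _ t1 = t by rewrite linearB /= fi subr0.
have fh1' : f _ h1' = h' by rewrite linearD /= fj addr0.
have ht1 : is_cycle t1.
  by apply: (is_cycle_diff0 (e := subrK 1 (- p))); rewrite linearB /= di subrr.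
have dh1' : dg_diff idx01 h1' = dg_mul (subrr p) s t1 - dg_one E.
  rewrite linearD linearB /=; apply: (addIr (dg_mul (subrr p) s i)).
  by rewrite -addrA [_ + dg_mul _ _ _]addrC -bij; zmodule.
have [h0 fh0] := fsurj _ h; have [u0 fu0] := fsurj _ u.
have [||||i' [j' [fi' fj' di' bij']]] := cone _ _ _ _ _ idx01 erefl erefl erefl
    (addr0 p)
    (dg_diff idx01 h0 - (dg_mul (addNr p) t1 s - dg_one E))
    (dg_mul erefl s h0 - sg k p *: dg_mul (addrC 1 p) h1' s - dg_diff erefl u0).
- by rewrite !linearB /= dg_fun_mul dg_fun_one dg_fun_diff ft1 fh0 e2; zmodule.
- by rewrite !linearB linearZ /= !dg_fun_mul dg_fun_diff fh0 fh1' fu0 e3; zmodule.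
- apply/is_cycleP => m e; have E9 : - p - 1 + p = m by lia.
  have E10 : - p + (p - 1) = m by lia.
  rewrite !linearB /= dg_diff_diff dg_diff_one.
  rewrite (dg_diff_mul _ _ (subrK 1 (- p)) (subrK 1 p) E9 E10) (cycle0 _ hs)
    (cycle0 _ ht1).
  by rewrite dmul0l linear0 scaler0; zmodule.
- rewrite linearB linearB linearZ /= dg_diff_diff [LHS]subr0.
  rewrite (dg_diff_mul _ _ (subrK 1 p) idx01 e6 (addr0 p))
    (cycle0 _ hs) dmul0l add0r.
  rewrite (dg_diff_mul (addrC 1 p) _ idx01 (subrK 1 p) (add0r p) e8)
    (cycle0 _ hs) linear0.
  by rewrite scaler0 addr0 dh1' -(dmul_sandwich s t1 (addr0 p)
    (add0r p)) -scalerBr -linearB.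
exists t1, h1', (h0 - i'), (u0 + j'); split => //.
- split=> //; first by rewrite linearB /= di'; zmodule.
  rewrite linearD linearB /=; apply: (addIr (dg_mul erefl s i')).
  by rewrite -addrA [_ + dg_mul _ _ _]addrC -bij'; zmodule.
- by rewrite linearB /= fi' subr0.
- by rewrite linearD /= fj' addr0.
Qed.

(** The relative freeness of [hinv_alg] over [base_alg], in the form used both
    to compute its homology and to transfer the lifting property to [C]. *)
Lemma hinv_alg_lifting (E B : dgAlg k) (f : dgHom E B) (b : dgHom hinv_alg B)
    (v : dgHom base_alg E) :
  (forall n (y : B n), exists x, f n x = y) ->
  (forall g, cone_acyclic f (v _ (base_gen (GenS g)))) ->
  dg_comp f v = dg_comp b base_to_hinv ->
  exists l : dgHom hinv_alg E, dg_comp f l = b /\ dg_comp l base_to_hinv = v.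
Proof.
move=> fsurj cone fv.
have fvE x : f _ (v _ (base_gen x)) = b _ (hinv_gen (GenBase x)).
  by rewrite -[LHS]/(dg_comp f v _ _) fv /= base_to_hinvE.
have vS g : is_cycle (v _ (base_gen (GenS g))) by apply: is_cycle_hom;
    exact: base_gen_S.
have inv g : exists w : E (- deg g) * E 1 * E 1 * E (deg g + 1 + 1),
  [/\ inverse_data (v _ (base_gen (GenS g))) w.1.1.1 w.1.1.2 w.1.2 w.2,
      f _ w.1.1.1 = b _ (hinv_gen (GenInv g)), f _ w.1.1.2 = b _ (hinv_gen
        (GenRight g)),
      f _ w.1.2 = b _ (hinv_gen (GenLeft g)) & f _ w.2 = b _ (hinv_gen (GenCoh g))].
  have /(inverse_data_lifting fsurj (vS g) (cone g)) :
    inverse_data (f _ (v _ (base_gen (GenS g)))) (b _ (hinv_gen (GenInv g)))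
      (b _ (hinv_gen (GenRight g)))
      (b _ (hinv_gen (GenLeft g))) (b _ (hinv_gen (GenCoh g))).
    by rewrite fvE; exact: inverse_data_hom (hinv_gen_inverse_data g).
  by move=> [t [h' [h [u [inv e1 e2 e3 e4]]]]]; exists (t, h', h, u).
pose w g := sval (cid (inv g)).
pose y n (c : C n) : E n := sval (cid (fsurj _ (b _ (hinv_gen (GenDisk2 c))))).
have hw g : [/\ inverse_data (v _ (base_gen (GenS g))) (w g).1.1.1 (w g).1.1.2
    (w g).1.2 (w g).2,
      f _ (w g).1.1.1 = b _ (hinv_gen (GenInv g)), f _ (w g).1.1.2 = b _
        (hinv_gen (GenRight g)),
      f _ (w g).1.2 = b _ (hinv_gen (GenLeft g)) & f _ (w g).2 = b _ (hinv_gen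
        (GenCoh g))].
  by rewrite /w; case: cid.
have [|||l [lF lT lH' lH [lK lY]]] := @hinv_alg_map E (fun x => v _ (base_gen x))
    (fun g => (w g).1.1.1) (fun g => (w g).1.1.2) (fun g => (w g).1.2)
    (fun g => (w g).2) y vS.
- by move=> n a; rewrite -dg_fun_diff base_gen_disk.
- by move=> n a; apply: is_cycle_hom; exact: base_gen_disk_bd.
- by move=> g; case: (hw g).
have lj : dg_comp l base_to_hinv = v.
  apply: base_alg_hom_eq => [g|n a].
    by rewrite -[LHS]/(l _ (base_to_hinv _ (base_gen (GenS g)))) base_to_hinvE;
      exact: (lF (GenS g)).
  by rewrite -[LHS]/(l _ (base_to_hinv _ (base_gen
    (GenDisk a)))) base_to_hinvE; exact: (lF (GenDisk a)).
exists l; split=> //; apply: hinv_alg_hom_eq.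
- have -> : dg_comp (dg_comp f l) base_to_hinv = dg_comp f (dg_comp l base_to_hinv).
    by apply: dgHom_eq.
  by rewrite lj.
- by move=> g /=; rewrite lT; case: (hw g).
- by move=> g /=; rewrite lH'; case: (hw g).
- by move=> g /=; rewrite lH; case: (hw g).
- by move=> g /=; rewrite lK; case: (hw g).
- by move=> n c /=; rewrite lY /y; case: cid.
Qed.

End Resolutions.

(** * Triangular algebras over a product, and mapping paths *)

Section GluePair.
Variables (k : comPzRingType) (A B : dgAlg k) (M : bimod A B) (sigma : M (- 1)).
Hypothesis bdiff_sigma : forall m (e : m + 1 = - 1), bdiff e sigma = 0.

Definition glue_pair : dgHom (glue bdiff_sigma) (prod_alg A B) :=
  prod_pair (glue_fst bdiff_sigma) (glue_snd bdiff_sigma).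

Lemma glue_pair_surj n (y : prod_alg A B n) : exists x, glue_pair n x = y.
Proof. by case: y => a b; exists (a, 0, b). Qed.

(** A map to the triangular algebra is a pair of maps with a homotopy between the
    two induced actions on [sigma]; on a cycle that [p] kills, the homotopy
    reads [d th = - sigma z]. *)
Lemma glue_lift_null (C : dgAlg k) (f : dgHom C (glue bdiff_sigma))
    (p : dgHom C A) (q : dgHom C B) n m (e : m + 1 = n) (z : C n) :
  dg_comp glue_pair f = prod_pair p q -> is_cycle z -> p n z = 0 ->
  bdiff e (f n z).1.2 = - ract (glue_idxl e) sigma (q n z).
Proof.
move=> fpq hz pz.
have E : glue_pair n (f n z) = (p n z, q n z).
  by rewrite -[LHS]/(dg_comp glue_pair f n z) fpq.
have /(congr1 (fun u : glue bdiff_sigma m => u.1.2)) := cycle0 e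
    (is_cycle_hom f hz).
case: E; case: (f n z) => -[a th] b /= -> ->; rewrite pz lact0l scaler0 subr0.
by move/eqP; rewrite addr_eq0 => /eqP.
Qed.

End GluePair.

Section Cylinder.
Variables (k : comPzRingType) (A D : dgAlg k) (i : dgHom A D).

Let odd1 : sg k 1 = -1. Proof. exact: sg1. Qed.
(** With the shifted regular bimodule and the unit as [sigma], a matrix is a
    point [a] of [A], a point [b] of [D] and a path from [i a] to [b]. *)
Definition path_bimod : bimod A D := reg i (dg_id D) odd1.

Fact path_unit (m : int) (e : m + 1 = - 1) :
  bdiff e (dg_one D : path_bimod (- 1)) = 0.
Proof. by rewrite /= dg_diff_one oppr0. Qed.

Definition mapping_path : dgAlg k := glue path_unit.

Lemma path_ract m n (e : - 1 + n = m) (z : D n) (e' : n = m + 1) :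
  ract e (dg_one D : path_bimod (- 1)) z = ecast j (D j) e' z :> D (m + 1).
Proof. by rewrite /=; case: (m + 1) / e' (shift_idxr 1 e) => e';
  exact: dg_mul1l. Qed.

Lemma path_lact m n (e : n - 1 = m) (x : A n) (e' : n = m + 1) :
  lact e x (dg_one D : path_bimod (- 1)) =
    sg k n *: ecast j (D j) e' (i n x) :> D (m + 1).
Proof. by rewrite /=; case: (m + 1) / e' (shift_idxl 1 e) => e';
  congr (_ *: _); exact: dg_mul1r. Qed.

End Cylinder.

(** The maps [i \o p] and the identity agree on [S] and the contractible pairs
    lift, so [base_alg] maps to the mapping path algebra of [i] over [p] and the
    identity: this is a homotopy between [i \o p] and the identity. *)
Lemma base_alg_kernel_exact (k : comPzRingType) (G : Type) (deg : G -> int)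
    (Q A : dgAlg k)
    (p : dgHom (base_alg deg Q) A) (i : dgHom A (base_alg deg Q)) :
  (forall g, i _ (p _ (base_gen deg (GenS Q g))) = base_gen deg (GenS Q g)) ->
  forall n (z : base_alg deg Q n), is_cycle z -> p n z = 0 ->
  exists y : base_alg deg Q (n + 1), dg_diff erefl y = z.
Proof.
move=> ip n z hz pz.
pose s g : mapping_path i (deg g) := (p _ (base_gen deg
  (GenS Q g)), 0, base_gen deg (GenS Q g)).
have hs g : is_cycle (s g).
  apply/is_cycleP => m e; congr (_, _, _).
  - by apply: cycle0; apply: is_cycle_hom; exact: base_gen_S.
  - have e' : deg g = m + 1 by [].
    rewrite linear0 [ract _ _ _](path_ract _ _ _ e') [lact _ _ _](path_lact _ _
      _ e').
    by rewrite sgZK ip add0r subrr.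
  - by apply: cycle0; exact: base_gen_S.
have [u [fu _]] := base_alg_lifting (glue_pair_surj (path_unit i))
  (b := prod_pair p (dg_id _)) hs (fun g => erefl).
have [m E] : exists m : int, n = m + 1 by exists (n - 1); rewrite subrK.
subst n.
have := glue_lift_null erefl fu hz pz; rewrite (path_ract _ _ _ erefl) => /oppr_inj.
by move=> e; exists (u _ z).1.2; rewrite -[RHS]e; congr (dg_diff _ _);
  exact: eq_irrelevance.
Qed.

(** * The bimodule of functions on reduced words *)

Section DependentFunctions.
Variables (k : comPzRingType) (I : Type) (F : I -> lmodType k).

Definition dfun := forall i, F i.

HB.instance Definition _ := gen_eqMixin dfun.
HB.instance Definition _ := gen_choiceMixin dfun.

Let addA : associative (fun f g : dfun => fun i => f i + g i).
Proof. by move=> f g h; apply: functional_extensionality_dep => i;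
  exact: addrA. Qed.
Let addC : commutative (fun f g : dfun => fun i => f i + g i).
Proof. by move=> f g; apply: functional_extensionality_dep => i; exact: addrC. Qed.
Let add0 : left_id (fun i => 0 : F i) (fun f g : dfun => fun i => f i + g i).
Proof. by move=> f; apply: functional_extensionality_dep => i; exact: add0r. Qed.
Let addN : left_inverse (fun i => 0 : F i) (fun f : dfun => fun i => - f i)
  (fun f g : dfun => fun i => f i + g i).
Proof. by move=> f; apply: functional_extensionality_dep => i; exact: addNr. Qed.

HB.instance Definition _ := GRing.isZmodule.Build dfun addA addC add0 addN.

Let scaleA b c (f : dfun) :
  (fun i => b *: (c *: f i)) = (fun i => (b * c) *: f i) :> dfun.
Proof. by apply: functional_extensionality_dep => i; exact: scalerA. Qed.
Let scale1 : left_id 1 (fun c (f : dfun) => (fun i => c *: f i) : dfun).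
Proof. by move=> f; apply: functional_extensionality_dep => i; exact: scale1r. Qed.
Let scaleDr : right_distributive (fun c (f : dfun) =>
  (fun i => c *: f i) : dfun) +%R.
Proof. by move=> c f g; apply: functional_extensionality_dep => i;
  exact: scalerDr. Qed.
Let scaleDl (f : dfun) : {morph (fun c =>
  (fun i => c *: f i) : dfun) : b c / b + c}.
Proof. by move=> b c; apply: functional_extensionality_dep => i;
  exact: scalerDl. Qed.

HB.instance Definition _ := GRing.Zmodule_isLmodule.Build k dfun
  scaleA scale1 scaleDr scaleDl.

End DependentFunctions.

Section ReducedWords.
Variable G : Type.
Local Notation letter := (G + G)%type.

Definition linv (a : letter) : letter :=
  match a with inl g => inr g | inr g => inl g end.

Lemma linvK : involutive linv. Proof. by case. Qed.

Fixpoint reduced (w : seq letter) : Prop :=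
  if w is a :: w' then ohead w' <> Some (linv a) /\ reduced w' else True.

Definition word_mul (a : letter) (w : seq letter) : seq letter :=
  match w with
  | b :: w' => if pselect (b = linv a) then w' else a :: w
  | [::] => [:: a]
  end.

Lemma word_mul_reduced a w : reduced w -> reduced (word_mul a w).
Proof.
case: w => [|b w] //= [hb hw]; case: pselect => //= ba; split=> //.
by case=> /ba.
Qed.

Lemma word_mulK a w : reduced w -> word_mul (linv a) (word_mul a w) = w.
Proof.
case: w => [_|b w [hb hw]] /=.
  by case: pselect => //; rewrite linvK.
case: (pselect (b = linv a)) => [E|nE] /=; last first.
  by case: pselect => //; rewrite linvK.
case: w hb {hw} => [|c w] /=; rewrite E //.
by rewrite linvK => hc; case: pselect => // ?; case: hc; congr Some.
Qed.

(** Reduced words are written from right to left: the head of the list is the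
    last letter, so that [rword_mul a] is multiplication by [a] on the right. *)
Definition rword := {w : seq letter | reduced w}.

Definition rword_mul (a : letter) (w : rword) : rword :=
  exist _ _ (word_mul_reduced a (svalP w)).

Lemma rword_mulK a w : rword_mul (linv a) (rword_mul a w) = w.
Proof. by case: w => w hw; apply: eq_exist; exact: word_mulK. Qed.

End ReducedWords.

Section Tree.
Variables (k : comPzRingType) (G : Type) (deg : G -> int) (Y : dgAlg k).
Implicit Types i j l m n : int.

(** An element of the bimodule is a function on reduced words with values in the
    product of all the [Y m], whatever its degree.  Not imposing that the value
    at [w] be homogeneous of the degree prescribed by [w] avoids every transport
    along equations between degrees; the signs of the differential, which
    depend on both the degree of the element and that of the component, keep the
    Leibniz rules valid. *)
Let T := @dfun k (rword G * int) (fun p => Y p.2).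
Let K := free_inv_alg k deg.

Definition translate (a : G + G) (th : T) : T := fun p => th (rword_mul a p.1, p.2).

(** The action of [K] is defined on terms, as composition of translations, and
    descends to [K] because translation by [s] and by [s^-1] are inverse. *)
Fixpoint term_act n (t : gterm k (deg_inv deg) n) (th : T) : T :=
  match t with
  | TGen a => translate a th
  | TZero _ => 0
  | TAdd _ t u => term_act t th + term_act u th
  | TScale _ c t => c *: term_act t th
  | TOne => th
  | TMul _ _ _ _ t u => term_act t (term_act u th)
  end.

Lemma term_act_linear n (t : gterm k (deg_inv deg) n) : linear (term_act t).
Proof.
elim: t => {n} //=.
- by move=> n c x y; rewrite scaler0 addr0.
- by move=> n t ht u hu c x y; rewrite ht hu scalerDr; zmodule.
- by move=> n b t ht c x y; rewrite ht scalerDr !scalerA mulrC.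
- by move=> i j n e t ht u hu c x y; rewrite hu ht.
Qed.

(** The action of [K] only moves words, so it commutes with whatever is done to
    the values: the action of [Y] and the differential. *)
Lemma term_act_natural (R : T -> T) n (t : gterm k (deg_inv deg) n) th :
  linear R -> (forall a th, R (translate a th) = translate a (R th)) ->
  term_act t (R th) = R (term_act t th).
Proof.
move=> Rl Rm; elim: t th => {n} //=.
- by move=> n th; rewrite (linear_fun0 Rl).
- move=> n t ht u hu th; rewrite ht hu.
  by have := Rl 1 (term_act t th) (term_act u th); rewrite !scale1r.
- move=> n c t ht th; rewrite ht.
  by have := Rl c (term_act t th) 0; rewrite (linear_fun0 Rl) !addr0.
- by move=> i j n e t ht u hu th; rewrite hu ht.
Qed.

Lemma term_act_eq n (t u : gterm k (deg_inv deg) n) :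
  pres_eq (@inv_rel k G deg) t u -> term_act t =1 term_act u.
Proof.
elim=> {n t u} /=.
- move=> n t u [] s th /=; apply: functional_extensionality_dep => -[w m];
  by rewrite /translate /= ?(rword_mulK (inl s)) ?(rword_mulK (inr s)).
- by [].
- by move=> n t u _ h th; rewrite h.
- by move=> n t u v _ h _ h' th; rewrite h h'.
- by move=> n t t' u u' _ ht _ hu th; rewrite ht hu.
- by move=> n c t t' _ ht th; rewrite ht.
- by move=> i j n e t t' u u' _ ht _ hu th; rewrite hu ht.
- by move=> n t u v th; rewrite addrA.
- by move=> n t u th; rewrite addrC.
- by move=> n t th; rewrite add0r.
- by move=> n t th; rewrite scaleN1r addNr.
- by move=> n b c t th; rewrite scalerA.
- by move=> n t th; rewrite scale1r.
- by move=> n c t u th; rewrite scalerDr.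
- by move=> n b c t th; rewrite scalerDl.
- by [].
- move=> i j n e t u v th.
  by have := term_act_linear t 1 (term_act u th) (term_act v th); rewrite !scale1r.
- by [].
- move=> i j n e c t u th.
  by have := term_act_linear t c (term_act u th) 0;
    rewrite (linear_fun0 (term_act_linear t)) !addr0.
- by [].
- by [].
- by [].
Qed.

Definition word_act n (x : K n) : T -> T := term_act (repr x).

Lemma word_act_pcls n (t : gterm k (deg_inv deg) n) : word_act
    (pcls _ t : K n) =1 term_act t.
Proof. by apply: term_act_eq; exact: repr_pcls. Qed.

Lemma word_act_linear n c (x x' : K n) th :
  word_act (c *: x + x') th = c *: word_act x th + word_act x' th.
Proof.
have [t ->] := pcls_surj x; have [t' ->] := pcls_surj x'.
by rewrite -pclsZ -pclsD !word_act_pcls.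
Qed.

Lemma word_act0 n th : word_act (0 : K n) th = 0.
Proof. by rewrite -[0]pcls0 word_act_pcls. Qed.

Lemma word_actM i j n (e : i + j = n) (x : K i) (y : K j) th :
  word_act (dg_mul e x y) th = word_act x (word_act y th).
Proof.
have [t ->] := pcls_surj x; have [u ->] := pcls_surj y.
by rewrite [dg_mul e _ _]pres_mulE !word_act_pcls.
Qed.

Definition tree_ract j (th : T) (y : Y j) : T :=
  fun p => dg_mul (subrK j p.2) (th (p.1, p.2 - j)) y.

Lemma tree_ractE j (th : T) (y : Y j) w m a (e : a + j = m) :
  tree_ract th y (w, m) = dg_mul e (th (w, a)) y.
Proof.
have E : a = m - j by rewrite -e addrK.
by subst a; rewrite /tree_ract /=; congr (dg_mul _ _ _); exact: eq_irrelevance.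
Qed.

Definition tree_diff n (th : T) : T :=
  fun p => sg k (p.2 + 1 + n) *: dg_diff (erefl (p.2 + 1)) (th (p.1, p.2 + 1)).

Lemma tree_diffE n (th : T) w m a (e : m + 1 = a) :
  tree_diff n th (w, m) = sg k (a + n) *: dg_diff e (th (w, a)).
Proof. by subst a. Qed.

Lemma tree_diff_linear n : linear (tree_diff n).
Proof.
move=> c th th'; apply: functional_extensionality_dep => p.
transitivity (sg k (p.2 + 1 + n) *: dg_diff erefl
  (c *: th (p.1, p.2 + 1) + th' (p.1, p.2 + 1))); first by [].
by rewrite [dg_diff _ _]linearP /= scalerDr !scalerA mulrC -scalerA.
Qed.

Lemma tree_ract_linear j (y : Y j) : linear (fun th => tree_ract th y).
Proof.
by move=> c th th'; apply: functional_extensionality_dep => p;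
  exact: dg_mul_linearl.
Qed.

Definition tree : bimod K Y.
Proof.
refine (@Bimod k K Y (fun _ => T) (fun i j n _ x th => word_act x th)
  (fun i j n _ th y => tree_ract th y) (fun m n _ th => tree_diff n th)
  _ _ _ _ _ _ _ _ _ _ _ _ _).
- by move=> i j n e th c x x'; exact: word_act_linear.
- by move=> i j n e x; exact: term_act_linear.
- by move=> i j n e y; exact: tree_ract_linear.
- move=> i j n e th c y y'; apply: functional_extensionality_dep => p.
  exact: dg_mul_linearr.
- by move=> m n e; exact: tree_diff_linear.
- by move=> i j l ij jl n eij ejl e e' x x' th; rewrite word_actM.
- move=> i j l ij jl n eij ejl e e' x th y.
  apply: (@term_act_natural (fun th => tree_ract th y) _ (repr x) th) => //.
  exact: tree_ract_linear.
- move=> i j l ij jl n eij ejl e e' th y y'.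
  apply: functional_extensionality_dep => -[w m].
  have e1 : m - jl + jl = m by rewrite subrK.
  have e2 : m - l + l = m by rewrite subrK.
  have e3 : m - jl + j = m - l by lia.
  rewrite (tree_ractE _ _ _ e1) (tree_ractE _ _ _ e2) (tree_ractE _ _ _ e3).
  exact: dg_mulA.
- by move=> n e th; exact: word_act_pcls.
- move=> n e th; apply: functional_extensionality_dep => -[w m].
  by rewrite (tree_ractE _ _ _ (addr0 m)) dg_mul1r.
- move=> l m n e e' th; apply: functional_extensionality_dep => -[w a].
  by rewrite /tree_diff /= linearZ /= dg_diff_diff !scaler0.
- move=> i i' j j' n n' e en ei ej e1 e2 x th.
  rewrite -[dg_diff ei x]/(0 : K i') word_act0 add0r.
  rewrite [word_act x (tree_diff j th)](@term_act_natural (tree_diff j)) //;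
    last exact: tree_diff_linear.
  apply: functional_extensionality_dep => -[w m].
  transitivity (sg k i *: tree_diff j (word_act x th) (w, m)); last by [].
  rewrite !(tree_diffE _ _ _ erefl) scalerA -sgD.
  by congr (sg k _ *: _); lia.
- move=> i i' j j' n n' e en ei ej e1 e2 th y.
  apply: functional_extensionality_dep => -[w m].
  have a1 : m - j + 1 + j = m + 1 by lia.
  have a2 : m - j + j = m by lia.
  have a3 : m - j + 1 + j' = m by lia.
  rewrite (tree_diffE _ _ _ erefl) (tree_ractE _ _ _ a1).
  rewrite (dg_diff_mul a1 _ erefl ej a2 a3).
  transitivity (tree_ract (tree_diff i th) y (w, m) + sg k i *: tree_ract th
    (dg_diff ej y) (w, m)); last by [].
  rewrite (tree_ractE _ _ _ a2) (tree_ractE _ _ _ a3)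
    (tree_diffE _ _ _ erefl) dmulZl.
  rewrite scalerDr !scalerA -sgD; congr (_ *: _ + _ *: _).
    by apply: (@sg_eq _ j); lia.
  by apply: (@sg_eq _ (m + 1)); lia.
Defined.

(** The unit of [Y] as an element of the product of all the [Y m]. *)
Definition one_family : dfun (fun m : int => Y m) := fun m =>
  match 0 =P m with ReflectT e => ecast q (Y q) e (dg_one Y) | _ => 0 end.

Lemma one_family0 : one_family 0 = dg_one Y.
Proof. by rewrite /one_family; case: eqP => // e;
  rewrite (eq_irrelevance e erefl). Qed.

Lemma one_family_cycle m : is_cycle (one_family m).
Proof.
rewrite /one_family; case: eqP => [e|_]; last by apply/is_cycleP => n e;
  rewrite linear0.
by case: m / e; exact: cycle_one_subproof.
Qed.

Section WordEval.
Variable y : forall a : G + G, Y (deg_inv deg a).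

Fixpoint word_eval (w : seq (G + G)) : dfun (fun m : int => Y m) :=
  if w is a :: w' then
    fun m => dg_mul (subrK (deg_inv deg a) m) (word_eval w'
      (m - deg_inv deg a)) (y a)
  else one_family.

Lemma word_evalE a w n m (e : n + deg_inv deg a = m) :
  word_eval (a :: w) m = dg_mul e (word_eval w n) (y a).
Proof.
have E : n = m - deg_inv deg a by rewrite -e addrK.
by subst n => /=; congr (dg_mul _ _ _); exact: eq_irrelevance.
Qed.

Hypothesis y_cycle : forall a, is_cycle (y a).

Lemma word_eval_cycle w m : is_cycle (word_eval w m).
Proof.
elim: w m => [|a w IH] m; first exact: one_family_cycle.
exact: (cycle_mul_subproof _ (Cycles (IH _)) (Cycles (y_cycle a))).
Qed.

(** The sign makes the commutator with this element the difference of
    [sigma(w) s] and [sigma(ws)] up to a sign common to both terms. *)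
Definition tree_base : tree (- 1) := fun p => sg k p.2 *: word_eval (sval p.1) p.2.

Lemma tree_base_closed m (e : m + 1 = - 1) : bdiff e tree_base = 0.
Proof.
apply: functional_extensionality_dep => -[w a].
rewrite [LHS](tree_diffE _ _ _ erefl) /tree_base linearZ /= (cycle0 _
  (word_eval_cycle _ _)).
by rewrite !scaler0.
Qed.

End WordEval.
End Tree.

(** * Homology of the algebra with homotopy inverses *)

Section TreeGlue.
Variables (k : comPzRingType) (G : Type) (deg : G -> int) (Y : dgAlg k).
Variables (s : forall g, Y (deg g)) (t : forall g, Y (- deg g)) (h : G -> Y 1).
Hypothesis s_cycle : forall g, is_cycle (s g).
Hypothesis t_cycle : forall g, is_cycle (t g).
Hypothesis diff_h : forall g,
  dg_diff idx01 (h g) = dg_mul (addNr (deg g)) (t g) (s g) - dg_one Y.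
Let K := free_inv_alg k deg.

Definition letter_val (a : G + G) : Y (deg_inv deg a) :=
  match a with inl g => s g | inr g => t g end.

Lemma letter_val_cycle a : is_cycle (letter_val a).
Proof. by case: a. Qed.

(** Values of words use a left homotopy inverse [t], with [ts - 1] bounded by
    [h]. *)
Definition tree_glue : dgAlg k := glue (tree_base_closed letter_val_cycle).

Let wv := word_eval letter_val.

(** The element [sigma(v) h], up to sign, at words [w = v s^-1], whose head is
    [inr g]. *)
Definition correction g : tree deg Y (deg g) := fun p =>
  match sval p.1 with
  | inr g' :: v =>
      if pselect (g' = g) is left _
      then sg k (p.2 - 1) *: dg_mul (subrK 1 p.2) (wv v (p.2 - 1)) (h g) else 0
  | _ => 0
  end.

Definition tree_gen g : tree_glue (deg g) :=
  (pgen (@inv_rel k G deg) (inl g), correction g, s g).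

Lemma word_act_gen (a : G + G) (th : tree deg Y 0) (w : rword G) m :
  word_act (pgen (@inv_rel k G deg) a) th (w, m) = th (rword_mul a w, m).
Proof. by rewrite [word_act _ _]word_act_pcls. Qed.

(** Evaluating a word is multiplicative except for the cancellation of [s^-1]
    against [s], which replaces [ts] by [1]; [correction] bounds the defect. *)
Lemma tree_gen_cycle g : is_cycle (tree_gen g).
Proof.
apply/is_cycleP => m e; congr (_, _, _); last exact: cycle0.
apply: functional_extensionality_dep => -[w a].
have e1 : a - deg g + deg g = a by lia.
transitivity (sg k (a + 1 + deg g) *: dg_diff (erefl (a + 1)) (correction g
  (w, a + 1))
  + dg_mul e1 (sg k (a - deg g) *: wv (sval w) (a - deg g)) (s g)
  - sg k (deg g) *: (sg k a *: wv (word_mul (inl g) (sval w)) a)).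
  congr (_ + _ - _ *: _).
    exact: (tree_ractE (tree_base letter_val : tree deg Y (-1)) (s g) w e1).
  exact: (word_act_gen (inl g) (tree_base letter_val) w a).
have sE : sg k (a - deg g) = sg k (deg g) * sg k a.
  by rewrite -sgD; apply: (@sg_eq _ (- deg g)); lia.
rewrite dmulZl sE scalerA.
have gE (w' : seq (G + G)) : wv (inl g :: w') a = dg_mul e1 (wv w' (a - deg g))
    (s g).
  exact: (@word_evalE k G deg Y letter_val (inl g) w' _ _ e1).
have triv (w' : seq (G + G)) : word_mul (inl g) w' = inl g :: w' ->
    correction g (w, a + 1) = 0 -> w' = sval w ->
  sg k (a + 1 + deg g) *: dg_diff (erefl (a + 1)) (correction g (w, a + 1)) +
    (sg k (deg g) * sg k a) *: dg_mul e1 (wv (sval w) (a - deg g)) (s g) -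
    (sg k (deg g) * sg k a) *: wv (word_mul (inl g) (sval w)) a = 0.
  by move=> E c0 <-; rewrite c0 linear0 scaler0 add0r E gE subrr.
case: w triv => -[|[g'|g'] v] hw triv.
- exact: (triv [::]).
- by apply: (triv (inl g' :: v)) => //=; case: pselect.
case: (pselect (g' = g)) => [E|nE]; last first.
  apply: (triv (inr g' :: v)) => //.
    by rewrite /=; case: pselect => // E; case: nE; case: E.
  by rewrite /correction /=; case: pselect.
subst g'; rewrite /correction /= {triv}.
case: pselect => // E1; case: pselect => // E2.
rewrite [RHS]/(0 : Y a); change (if is_left
  (left E2) then v else [:: inl g, inr g & v]) with v.
have e2 : a + 1 - 1 = a by lia.
move: (subrK 1 (a + 1)); rewrite e2 => e3.
have e4 : a - deg g - - deg g = a by lia.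
move: (subrK (- deg g) (a - deg g)); rewrite e4 => e5.
have e6 : a - 1 + 1 = a by lia.
rewrite -(dg_mulA _ (addNr (deg g)) (addr0 a)) linearZ /=.
rewrite (dg_diff_mul e3 _ (subrK 1 a) idx01 e6 (addr0 a)) (cycle0 _
  (word_eval_cycle letter_val_cycle v a)).
rewrite dmul0l add0r diff_h linearB /= dg_mul1r sgZK.
have -> : sg k (a + 1 + deg g) = - (sg k (deg g) * sg k a).
  by rewrite !sgD sg1 mulrN1 mulNr mulrC.
by rewrite scaleNr !scalerBr; zmodule.
Qed.

(** On the corner the generator acts by translation of words, which is
    bijective: the inverse translation solves the cone equations with [j = 0]. *)
Lemma tree_gen_cone g : cone_acyclic (glue_pair
    (tree_base_closed letter_val_cycle)) (tree_gen g).
Proof.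
have ract0r j (th : tree deg Y 0) : tree_ract th (0 : Y j) = 0.
  by apply: functional_extensionality_dep => p; exact: linear0.
have gK (a : G + G) (th : tree deg Y 0) : word_act (pgen (@inv_rel k G deg) a)
    (word_act (pgen (@inv_rel k G deg) (linv a)) th) = th.
  apply: functional_extensionality_dep => -[w m].
  by rewrite !word_act_gen rword_mulK.
move=> n n1 m m1 m' en em e1 e2 e3 [[xa a] ya] [[xb b] yb] [/= -> ->] [/= -> ->] _.
move=> /(congr1 (fun u : tree_glue m' => u.1.2)) /=.
rewrite !ract0r word_act0 scaler0 subr0 !addr0 => db.
exists ((0, word_act (pgen (@inv_rel k G deg) (inr g)) b, 0) : tree_glue n1), 0.
have e4 : - deg g - 1 + m = n by lia.
have e5 : - deg g + m' = n by lia.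
have e6 : - deg g + m = n1 by lia.
split=> //.
  congr (_, _, _) => /=; rewrite ?linear0 // ract0r word_act0 scaler0 subr0 addr0.
  apply: etrans (lact_leibniz e6 en (subrK _ _) e2 e4 e5 (pgen
    (@inv_rel k G deg) (inr g) : K _) b) _.
  rewrite [dg_diff _ _]/(0 : K _) lact0l add0r [bdiff e2 b]db.
  rewrite linearZ /= sgN sgZK; exact: (gK (inr g)).
have -> : glue_diff (tree_base letter_val) em 0 = 0 by exact: (linear0
    (@dg_diff k tree_glue _ _ em)).
rewrite addr0; congr (_, _, _) => /=; rewrite ?linear0 //.
  exact: (esym (linear0 (@dg_mul k K _ _ _ e1 (pgen (@inv_rel k G deg) (inl g))))).
by rewrite ract0r addr0; apply: esym; exact: (gK (inl g)).
Qed.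

End TreeGlue.

(** The projection and the identity lift to the triangular algebra; the corner of
    the lift, read at the empty word, bounds every cycle that dies in [K]. *)
Lemma hinv_alg_kernel_exact (k : comPzRingType) (G : Type) (deg : G -> int)
    (Q C : dgAlg k)
    (p : dgHom (hinv_alg deg Q C) (free_inv_alg k deg)) :
  (forall g, p _ (hinv_gen deg (GenBase C (GenS Q g))) = pgen
    (@inv_rel k G deg) (inl g)) ->
  forall n (z : hinv_alg deg Q C n), is_cycle z -> p n z = 0 ->
  exists y : hinv_alg deg Q C (n + 1), dg_diff erefl y = z.
Proof.
move=> pS n z hz pz.
pose Y := hinv_alg deg Q C.
pose s g : Y (deg g) := hinv_gen deg (GenBase C (GenS Q g)).
pose t g : Y (- deg g) := hinv_gen deg (GenInv Q C g).
pose h g : Y 1 := hinv_gen deg (GenLeft Q C g).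
have hs g : is_cycle (s g) by exact: hinv_gen_S.
have ht g : is_cycle (t g) by exact: hinv_gen_inv.
have dh g : dg_diff idx01 (h g) = dg_mul (addNr (deg g)) (t g)
    (s g) - dg_one Y by exact: hinv_gen_left.
pose W := tree_base_closed (letter_val_cycle hs ht).
pose b := prod_pair p (dg_id Y).
have [|v [fv vS]] := base_alg_lifting (b := dg_comp b (base_to_hinv deg Q C))
  (glue_pair_surj W) (tree_gen_cycle hs ht dh).
  move=> g; rewrite -[RHS]/(b _ (base_to_hinv deg Q C _ (base_gen deg
    (GenS Q g)))) base_to_hinvE.
  by congr (_, _); rewrite pS.
have [|l [fl _]] := hinv_alg_lifting (glue_pair_surj W) _ fv.
  by move=> g; rewrite vS; exact: tree_gen_cone.
pose nilw : rword G := exist _ [::] I.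
have := glue_lift_null (subrK 1 n) fl hz pz; set th := (l n z).1.2.
move/(congr1 (fun f : tree deg Y (n - 1) => f (nilw, n))).
rewrite [LHS](tree_diffE n th nilw (erefl (n + 1))).
have -> : (- tree_ract (tree_base (letter_val s t)) z : tree deg Y 0)
    (nilw, n) = - z.
  congr (- _); apply: etrans (tree_ractE _ _ _ (add0r n)) _.
  have -> : tree_base (letter_val s t) (nilw, 0) = dg_one Y.
    exact: etrans (scale1r _) (one_family0 Y).
  exact: dg_mul1l.
move=> e.
exists (- (sg k (n + 1 + n) *: th (nilw, n + 1))).
by rewrite linearN linearZ /= e opprK.
Qed.

(** * The lifting property of the localising cofibration *)

Section Localisation.
Variables (k : comPzRingType) (G : Type) (deg : G -> int) (Q C : dgAlg k).
Let F := free_alg k deg.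
Let K := free_inv_alg k deg.
Variables (q : dgHom Q F) (j : dgHom Q C) (r : dgHom C K).
Hypothesis Q_cof : cofibrant (Q : dgCat k).
Hypothesis q_qiso : @quasi_iso k Q F q.
Hypothesis j_cof : @cofibration k Q C j.
Hypothesis r_qiso : @quasi_iso k C K r.
Hypothesis rj : dg_comp r j = dg_comp (free_to_inv k deg) q.
Variable iota : forall g, Q (deg g).
Hypothesis iota_cycle : forall g, is_cycle (iota g).
Hypothesis q_iota : forall g, q _ (iota g) = pgen _ g.

Let ginv (a : G + G) : K (deg_inv deg a) := pgen (@inv_rel k G deg) a.

Lemma free_to_inv_gen g : free_to_inv k deg _ (pgen _ g) = ginv (inl g).
Proof. exact: (@pres_liftE k G deg (@no_rel k G deg) K). Qed.

Lemma r_iota g : r _ (j _ (iota g)) = ginv (inl g).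
Proof.
rewrite -[LHS]/(dg_comp r j _ _) rj /= -[LHS]/(free_to_inv k deg _ (q _ _)) q_iota.
exact: free_to_inv_gen.
Qed.

Lemma r_surj n (y : K n) : exists2 z : C n, is_cycle z & r n z = y.
Proof.
have [_ /(_ n y (is_cycle_pres y)) [z hz [b rz]]] := proj1 (quasi_isoP r) r_qiso.
by exists z => //; apply/eqP; rewrite -subr_eq0 rz.
Qed.

Lemma inv_r g : dg_mul (subrr (deg g)) (ginv (inl g)) (ginv (inr g)) = dg_one K.
Proof. by rewrite [LHS]pres_mulE; apply/pclsP/pe_rel; exact: inv_rel_r. Qed.

Lemma inv_l g : dg_mul (addNr (deg g)) (ginv (inr g)) (ginv (inl g)) = dg_one K.
Proof. by rewrite [LHS]pres_mulE; apply/pclsP/pe_rel; exact: inv_rel_l. Qed.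

Lemma j_iota_unit g : hunit (j _ (iota g)).
Proof.
have [t ht rt] := r_surj (ginv (inr g)).
have hs := is_cycle_hom j (iota_cycle g).
have hl : is_cycle (dg_mul (subrr (deg g)) (j _ (iota g)) t - dg_one C).
  exact: (valP (cycle_mul (subrr (deg g)) (Cycles hs) (Cycles ht) - cycle_one C)).
have hr : is_cycle (dg_mul (addNr (deg g)) t (j _ (iota g)) - dg_one C).
  exact: (valP (cycle_mul (addNr (deg g)) (Cycles ht) (Cycles hs) - cycle_one C)).
have [inj _] := proj1 (quasi_isoP r) r_qiso.
have [|h0 e0] := inj _ _ hl 0.
  by rewrite linear0 linearB /= dg_fun_mul dg_fun_one rt r_iota inv_r subrr.
have [|h1 e1] := inj _ _ hr 0.
  by rewrite linear0 linearB /= dg_fun_mul dg_fun_one rt r_iota inv_l subrr.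
by exists t, h0, h1; split=> //; rewrite (eq_irrelevance idx01 erefl).
Qed.

Lemma base_resolution : exists rho : dgHom (base_alg deg Q) Q,
  (forall g, rho _ (base_gen deg (GenS Q g)) = iota g) /\
  (forall n (a : Q n), rho _ (base_gen deg (GenDisk G a)) = a).
Proof. exact: (base_alg_map (fun n a => a) iota_cycle). Qed.

(** Composed with the quasi-isomorphism [q], this map retracts [base_alg] onto
    [F]. *)
Lemma base_resolution_qiso (rho : dgHom (base_alg deg Q) Q) :
  (forall g, rho _ (base_gen deg (GenS Q g)) = iota g) -> @quasi_iso k
    (base_alg deg Q) Q rho.
Proof.
move=> rhoS; apply: quasi_iso_cancel q_qiso _; apply/quasi_isoP.
pose i : dgHom F (base_alg deg Q) := free_lift (fun g => Cycles
  (base_gen_S deg Q g)).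
have iE g : i _ (pgen _ g) = base_gen deg (GenS Q g) by exact: pres_liftE.
have pi n (y : F n) : q _ (rho _ (i _ y)) = y.
  elim/pres_ind: n / y.
  - by move=> g; rewrite iE rhoS q_iota.
  - by move=> n; rewrite !linear0.
  - by move=> n x y hx hy; rewrite !linearD /= hx hy.
  - by move=> n c x hx; rewrite !linearZ /= hx.
  - by rewrite !dg_fun_one.
  - by move=> i' j' n e x y hx hy; rewrite !dg_fun_mul hx hy.
split=> [n z hz b pz|n y _].
  apply: (@base_alg_kernel_exact k G deg Q F (dg_comp q rho) i) hz _ => //.
  move=> g; rewrite -[dg_comp q rho _ _]/(q _ (rho _ _)) rhoS q_iota; exact: iE.
exists (i _ y); first by apply: is_cycle_hom; exact: is_cycle_pres.
by exists 0; rewrite linear0 /= pi subrr.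
Qed.

(** The image of [iota] in [C] is a unit in homology, so the inverse data of [s]
    in [K], where the homotopies vanish, lift along [r].  The composite with [r]
    is surjective on homology because [t] goes to [s^-1]. *)
Lemma hinv_resolution (rho : dgHom (base_alg deg Q) Q) :
  (forall g, rho _ (base_gen deg (GenS Q g)) = iota g) ->
  exists rho' : dgHom (hinv_alg deg Q C) C,
    [/\ dg_comp rho' (base_to_hinv deg Q C) = dg_comp j rho,
        (forall n (c : C n), rho' _ (hinv_gen deg (GenDisk2 G Q c)) = c)
      & @quasi_iso k (hinv_alg deg Q C) C rho'].
Proof.
move=> rhoS.
have rho_c x : is_cycle (base_gen deg x) -> is_cycle (j _ (rho _ (base_gen deg x))).
  by move=> hx; do 2!apply: is_cycle_hom.
have inv g : exists w : C (- deg g) * C 1 * C 1 * C (deg g + 1 + 1),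
  inverse_data (j _ (rho _ (base_gen deg (GenS Q g)))) w.1.1.1 w.1.1.2 w.1.2 w.2.
  have hu : hunit (j _ (rho _ (base_gen deg (GenS Q g)))) by rewrite rhoS;
      exact: j_iota_unit.
  have hs := rho_c (GenS Q g) (base_gen_S deg Q g).
  have [||t [h' [h [u [iv _ _ _ _]]]]] := @inverse_data_lifting k C K r _ _
    (ginv (inr g)) 0 0 0 _ hs (hunit_cone_acyclic hs hu).
  - by move=> n y; have [z _ <-] := r_surj y; exists z.
  - rewrite rhoS r_iota; split; first exact: is_cycle_pres.
    + by rewrite inv_r subrr.
    + by rewrite inv_l subrr.
    + by rewrite dmul0l scaler0 subr0 [LHS]linear0 [RHS]linear0.
  by exists (t, h', h, u).
pose w g := sval (cid (inv g)).
have hw g : inverse_data (j _ (rho _ (base_gen deg (GenS Q g)))) (w g).1.1.1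
    (w g).1.1.2
  (w g).1.2 (w g).2 by rewrite /w; case: cid.
have [|||rho' [rF rT rH' rH [rK rY]]] := @hinv_alg_map k G deg Q C C
  (fun x => j _ (rho _ (base_gen deg x))) (fun g => (w g).1.1.1) (fun g =>
    (w g).1.1.2)
  (fun g => (w g).1.2) (fun g => (w g).2) (fun n c => c) (fun g => rho_c _
    (base_gen_S deg Q g)).
- by move=> n a; rewrite -!dg_fun_diff base_gen_disk.
- by move=> n a; apply: rho_c; exact: base_gen_disk_bd.
- exact: hw.
exists rho'; split=> //.
  apply: base_alg_hom_eq => [g|n a].
    by rewrite -[LHS]/(rho' _ (base_to_hinv deg Q C _
      (base_gen _ _))) base_to_hinvE; exact: (rF (GenS Q g)).
  by rewrite -[LHS]/(rho' _ (base_to_hinv deg Q C _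
    (base_gen _ _))) base_to_hinvE; exact: (rF (GenDisk G a)).
apply: quasi_iso_cancel r_qiso _.
pose p := dg_comp r rho'.
have pS g : p _ (hinv_gen deg (GenBase C (GenS Q g))) = ginv (inl g).
  rewrite -[LHS]/(r _ (rho' _ _)) [rho' _ _](rF (GenS Q g)) /=.
  by rewrite -[LHS]/(r _ (j _ (rho _ (base_gen deg (GenS Q g))))) rhoS r_iota.
have pT g : p _ (hinv_gen deg (GenInv Q C g)) = ginv (inr g).
  have e : dg_mul (subrr (deg g)) (ginv (inl g)) (p _ (hinv_gen deg
      (GenInv Q C g))) = dg_one K.
    rewrite -[X in dg_mul _ X]pS -[LHS](dg_fun_mul p).
    have pB x y : p 0 (x - y) = p 0 x - p 0 y by exact: (linearB (p 0)).
    apply/eqP; rewrite -subr_eq0 -(dg_fun_one p) -pB -(hinv_gen_right deg Q C g).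
    by rewrite dg_fun_diff.
  have e1 : - deg g + 0 = - deg g by rewrite addr0.
  rewrite -[RHS](dg_mul1r e1) -e (dg_mulA (addNr (deg g)) _ _ (add0r _)) inv_l.
  by rewrite dg_mul1l.
apply/quasi_isoP; split=> [n z hz b pz|n y _];
  first exact: (hinv_alg_kernel_exact pS hz pz).
suff [z hz pz] : exists2 z, is_cycle z & p n z = y.
  by exists z => //; exists 0; rewrite linear0 pz subrr.
elim/pres_ind: n / y.
- case=> g; first by exists (hinv_gen deg (GenBase C (GenS Q g)));
    [exact: hinv_gen_S|exact: pS].
  by exists (hinv_gen deg (GenInv Q C g)); [exact: hinv_gen_inv|exact: pT].
- by move=> n; exists 0; [exact: (valP (0 : cycles
    (hinv_alg deg Q C) n))|rewrite linear0].
- move=> n _ _ [x hx <-] [y hy <-]; exists (x + y); last by rewrite linearD.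
  exact: (valP (Cycles hx + Cycles hy)).
- move=> n c _ [x hx <-]; exists (c *: x); last by rewrite linearZ.
  exact: (valP (c *: Cycles hx)).
- by exists (dg_one _); [exact: cycle_one_subproof|rewrite dg_fun_one].
- move=> i i' n e _ _ [x hx <-] [y hy <-]; exists (dg_mul e x y);
    last by rewrite dg_fun_mul.
  exact: (valP (cycle_mul e (Cycles hx) (Cycles hy))).
Qed.

(** The resolutions of [Q] and [C] split by cofibrancy of [Q] and of [j], the
    second splitting being chosen to extend the first; this makes [j] a retract
    of [base_to_hinv], and lifting properties pass to retracts. *)
Lemma localising_lifting (E B : dgAlg k) (f : dgHom E B) (e : dgHom Q E)
    (b : dgHom C B) :
  (forall n (y : B n), exists x, f n x = y) ->
  (forall g, hunit (e _ (iota g))) -> dg_comp f e = dg_comp b j ->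
  exists l : dgHom C E, dg_comp l j = e /\ dg_comp f l = b.
Proof.
move=> fsurj eunit fe.
have compA (A1 A2 A3 A4 : dgAlg k) (h3 : dgHom A3 A4) (h2 : dgHom A2 A3)
    (h1 : dgHom A1 A2) :
  dg_comp h3 (dg_comp h2 h1) = dg_comp (dg_comp h3 h2) h1 by exact: dgHom_eq.
have [rho [rhoS rhoX]] := base_resolution.
have [rho' [rho'j rho'Y rho'_qiso]] := hinv_resolution rhoS.
have [u rhou] : exists u : dgHom Q (base_alg deg Q), dg_comp rho u = dg_id Q.
  have init := dgCat_initial k.
  have [iQ [_ iQ_uniq]] := proj2 init Q I.
  have [iF [_ iF_uniq]] := proj2 init (base_alg deg Q) I.
  have iQ_cof : cofibration iQ by exact: Q_cof init.
  have [|||u [_ rhou]] := iQ_cof (base_alg deg Q) Q rho _ _ iF (dg_id Q).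
  - by move=> n a; exists (base_gen deg (GenDisk G a)); exact: rhoX.
  - exact: base_resolution_qiso.
  - exact: etrans (esym (iQ_uniq (dg_comp rho iF) I)) (iQ_uniq (dg_comp
      (dg_id Q) iQ) I).
  by exists u.
have [||v [vj rho'v]] := j_cof (X := hinv_alg deg Q C) (Y := C)
    (p := rho') _ rho'_qiso
  (u := dg_comp (base_to_hinv deg Q C) u) (v := dg_id C).
- by move=> n c; exists (hinv_gen deg (GenDisk2 G Q c)); exact: rho'Y.
- rewrite [LHS]compA [dg_comp rho' _]rho'j -[LHS]compA rhou.
  exact: dgHom_eq.
have [||l [fl lj]] := hinv_alg_lifting (b := dg_comp b rho') fsurj
    (v := dg_comp e rho).
- move=> g; apply: hunit_cone_acyclic; first by apply: is_cycle_hom;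
    exact: base_gen_S.
  by rewrite -[dg_comp e rho _ _]/(e _ (rho _ _)) rhoS; exact: eunit.
- by rewrite -compA rho'j !compA fe.
exists (dg_comp l v); split.
  rewrite -compA [dg_comp v j]vj compA lj -compA rhou; exact: dgHom_eq.
rewrite compA fl -compA [dg_comp rho' v]rho'v; exact: dgHom_eq.
Qed.
End Localisation.

(** * Homotopies and initiality *)

Section Path.
Variables (k : comPzRingType) (Y : dgAlg k).

Definition path_alg : dgAlg k := mapping_path (dg_id Y).
Definition path_ev0 : dgHom path_alg Y := glue_fst (path_unit (dg_id Y)).
Definition path_ev1 : dgHom path_alg Y := glue_snd (path_unit (dg_id Y)).

Definition path_const : dgHom Y path_alg.
Proof.
refine (@DGHom k Y path_alg (fun n a => (a, 0, a)) _ _ _ _).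
- by move=> n c x y; congr (_, _, _) => /=; rewrite scaler0 addr0.
- by [].
- move=> i j n e a b; congr (_, _, _) => /=.
  by rewrite linear0 dmul0l scaler0 addr0.
- move=> m n e a; congr (_, _, _) => /=.
  have e' : n = m + 1 by [].
  have := path_ract (dg_id Y) (glue_idxl e) a e'.
  have := path_lact (dg_id Y) (glue_idxr e) a e' => /= -> ->.
  by rewrite linear0 oppr0 add0r sgZK subrr.
Defined.

(** A closed path from [a] to [b] differs from the constant path at [a] by the
    boundary of the path itself, placed in the second diagonal entry. *)
Lemma path_const_qiso : @quasi_iso k Y path_alg path_const.
Proof.
apply/quasi_isoP; split=> [n z hz [[b0 h] b1] /(congr1
  (fun u : path_alg n => u.1.1)) /= zb|n].
  by exists b0.
have [m E] : exists m : int, n = m + 1 by exists (n - 1); rewrite subrK.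
subst n => -[[a h] b] hab.
have := cycle0 erefl hab => /(congr1 (fun u : path_alg m => u.1.2)).
rewrite -[X in X = _ -> _]/(bdiff (erefl (m + 1)) h +
  ract (glue_idxl erefl) (dg_one Y : path_bimod (dg_id Y) (-1)) b -
  sg k (m + 1) *: lact (glue_idxr erefl) a (dg_one Y : path_bimod (dg_id Y) (-1))).
rewrite (path_ract _ _ _ erefl) (path_lact _ _ _ erefl) sgZK => /= dh.
have ha : is_cycle a by exact: (@is_cycle_hom k path_alg Y path_ev0 _
    (a, h, b) hab).
have {}dh : a - b = - dg_diff erefl (h : Y (m + 1 + 1)).
  move: dh; rewrite (eq_irrelevance (shift_idxr 1 erefl) erefl) => /eqP.
  by rewrite subr_eq0 => /eqP <-; zmodule.
exists a => //; exists (0, 0, - (h : Y (m + 1 + 1))).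
congr (_, _, _).
- by rewrite /= subrr linear0.
- transitivity (bdiff (erefl (m + 1 + 1)) (0 : path_bimod (dg_id Y) (m + 1 + 1)) +
    ract (glue_idxl erefl) (dg_one Y : path_bimod (dg_id Y) (-1)) (- (h : Y
      (m + 1 + 1))) -
    sg k (m + 1 + 1) *: lact (glue_idxr erefl) 0 (dg_one Y : path_bimod
      (dg_id Y) (-1))); last by [].
  rewrite (path_ract _ _ _ erefl) linear0 lact0l scaler0.
  by rewrite subr0.
- apply: etrans dh _; exact: (esym (linearN (@dg_diff k Y _ _ erefl) _)).
Qed.
End Path.

Lemma hunit_pair (k : comPzRingType) (A B : dgAlg k) p (a : A p) (b : B p) :
  hunit a -> hunit b -> hunit ((a, b) : prod_alg A B p).
Proof.
move=> [t [h0 [h1 [ht e0 e1]]]] [t' [h0' [h1' [ht' e0' e1']]]].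
exists (t, t'), (h0, h0'), (h1, h1'); split.
- by apply/is_cycleP => m e; congr (_, _); apply: cycle0.
- by congr (_, _).
- by congr (_, _).
Qed.

Lemma hunit_reflect (k : comPzRingType) (A B : dgAlg k) (w : dgHom A B) p
    (s : A p) :
  @quasi_iso k A B w -> is_cycle s -> hunit (w _ s) -> hunit s.
Proof.
move=> w_qiso hs /(hinvertibleP (is_cycle_hom w hs)) [y [sy ys]].
apply/(hinvertibleP hs).
have [z ez] : exists z, hmap w z = y.
  by have [v _ vK] := w_qiso (- p); exists (v y).
have inj n : injective (@hmap k A B w n) by apply: bij_inj.
have wM a b n (e : a + b = n) (u : homology A a) (v : homology A b) :
  hmap w (hmul e u v) = hmul e (hmap w u) (hmap w v).
  have [u' ->] := hclass_surj u; have [v' ->] := hclass_surj v.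
  rewrite hmulE !hmapE hmulE; apply/hclassP; exists 0.
  by rewrite linear0 /= dg_fun_mul subrr.
have w1 : hmap w (hone A) = hone B.
  by rewrite /hone hmapE; apply/hclassP; exists 0;
    rewrite linear0 /= dg_fun_one subrr.
have ws : hmap w (hclass (Cycles hs)) = hclass (Cycles (is_cycle_hom w hs)).
  by rewrite hmapE; apply/hclassP; exists 0; rewrite linear0 /= subrr.
by exists z; split; apply: inj; rewrite wM w1 ez ws.
Qed.

Section Assembly.
Variables (k : comPzRingType) (P : dgAlg k).
Let UP := @under (dgCat k) P.
Variables (G : Type) (deg : G -> int) (Q C : dgAlg k) (i : dgHom Q P)
  (j : dgHom Q C).
Variable iota : forall g, Q (deg g).
Hypothesis iota_cycle : forall g, is_cycle (iota g).
Hypothesis lift : forall (E B : dgAlg k) (f : dgHom E B) (e : dgHom Q E)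
  (b : dgHom C B),
  (forall n (y : B n), exists x, f n x = y) ->
  (forall g, hunit (e _ (iota g))) -> dg_comp f e = dg_comp b j ->
  exists l : dgHom C E, dg_comp l j = e /\ dg_comp f l = b.
Hypothesis j_unit : forall g, hunit (j _ (iota g)).

(** For the chosen cycles this says that [Y] is [S]-inverting, but it passes more
    easily along maps. *)
Definition unitary (Y : UP) : Prop :=
  forall g, hunit ((under_map Y : dgHom P (under_tgt Y)) _ (i _ (iota g))).

Variables (X : UP) (x : dgHom C (under_tgt X)).
Hypothesis po : @is_pushout (dgCat k) Q P C (under_tgt X) i j (under_map X) x.

Lemma pushout_unitary : unitary X.
Proof.
move=> g; have [sq _] := po.
rewrite -[_ (i _ _)]/((dg_comp (under_map X) i) _ _).
have -> : dg_comp (under_map X) i = dg_comp x j by exact: sq.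
exact: (hunit_hom x (j_unit g)).
Qed.

Lemma pushout_hom_eq (Z : dgAlg k) (f f' : dgHom (under_tgt X) Z) :
  dg_comp f (under_map X) = dg_comp f' (under_map X) ->
  dg_comp f x = dg_comp f' x -> f = f'.
Proof.
move=> fX fx; have [sq uni] := po.
have [|v [_ vu]] := uni Z (dg_comp f (under_map X)) (dg_comp f x).
  apply: dgHom_eq => n a; congr (f _ _).
  have sq' : dg_comp (under_map X) i = dg_comp x j by exact: sq.
  exact: (congr1 (fun h : dgHom Q (under_tgt X) => h n a) sq').
rewrite -[LHS]vu; last by [].
by apply: vu; split; apply: esym.
Qed.

(** A filler of the square over the projection [Y * C -> C] is the graph of a map
    [C -> Y] that agrees with [Q -> P -> Y] on [Q]. *)
Lemma strict_map_exists (Y : UP) : unitary Y -> exists f : @Defs.hom UP X Y, True.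
Proof.
move=> uY; pose y : dgHom P (under_tgt Y) := under_map Y.
have [|||l [lj _]] := lift (f := prod_snd (under_tgt Y) C)
    (e := prod_pair (dg_comp y i) j) (b := dg_id C).
- by move=> n c; exists (0, c).
- by move=> g; apply: hunit_pair => //; exact: uY.
- exact: dgHom_eq.
pose y' := dg_comp (prod_fst (under_tgt Y) C) l.
have [_ uni] := po.
have [|w [[wX _] _]] := uni (under_tgt Y) y y'.
  apply: dgHom_eq => n a.
  by rewrite -[RHS]/((dg_comp l j _ a).1) lj.
by exists (exist _ w wX).
Qed.

Let W := under_class (q := P : dgCat k) (@quasi_iso k).

Definition strict_map (Z Y : UP) (f : @Defs.hom UP Z Y) : loc_hom W Z Y :=
  loc_class (zz_fwd f (zz_nil W Y)).

(** The lift to the path algebra of [Y] is a homotopy under [P]; its two ends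
    become equal because both evaluations are inverse to the constant path. *)
Lemma strict_map_uniq (Y : UP) (f f' : @Defs.hom UP X Y) :
  unitary Y -> zz_eq (zz_fwd f (zz_nil W Y)) (zz_fwd f' (zz_nil W Y)).
Proof.
move=> uY; pose y : dgHom P (under_tgt Y) := under_map Y.
pose T := path_alg (under_tgt Y).
pose c := path_const (under_tgt Y).
pose ev0 := path_ev0 (under_tgt Y); pose ev1 := path_ev1 (under_tgt Y).
pose f0 : dgHom (under_tgt X) (under_tgt Y) := sval f.
pose f1 : dgHom (under_tgt X) (under_tgt Y) := sval f'.
have f0X : dg_comp f0 (under_map X) = y by exact: (svalP f).
have f1X : dg_comp f1 (under_map X) = y by exact: (svalP f').
have [sq uni] := po.
have [|||l [lj ev]] := lift (f := prod_pair ev0 ev1) (e := dg_comp c (dg_comp y i))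
    (b := prod_pair (dg_comp f0 x) (dg_comp f1 x)).
- exact: (glue_pair_surj (path_unit (dg_id (under_tgt Y)))).
- by move=> g; apply: (hunit_hom c); exact: uY.
- apply: dgHom_eq => n a; congr (_, _).
    rewrite -[RHS]/(f0 _ (dg_comp x j _ a)).
    have <- : dg_comp (under_map X) i = dg_comp x j by exact: sq.
    by rewrite -[RHS]/(dg_comp f0 (under_map X) _ _) f0X.
  rewrite -[RHS]/(f1 _ (dg_comp x j _ a)).
  have <- : dg_comp (under_map X) i = dg_comp x j by exact: sq.
  by rewrite -[RHS]/(dg_comp f1 (under_map X) _ _) f1X.
have [|w [[wX wC] _]] := uni T (dg_comp c y) l.
  by rewrite -[RHS]/(dg_comp l j) lj; exact: dgHom_eq.
pose YT : UP := @UnderOb (dgCat k) P T (dg_comp c y).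
pose w' : @Defs.hom UP X YT := exist _ w wX.
have cY : @ccomp (dgCat k) _ _ _ c (under_map Y) = under_map YT by [].
pose c' : @Defs.hom UP Y YT := exist _ c cY.
have e0Y : @ccomp (dgCat k) _ _ _ ev0 (under_map YT)
    = under_map Y by exact: dgHom_eq.
have e1Y : @ccomp (dgCat k) _ _ _ ev1 (under_map YT)
    = under_map Y by exact: dgHom_eq.
pose e0 : @Defs.hom UP YT Y := exist _ ev0 e0Y.
pose e1 : @Defs.hom UP YT Y := exist _ ev1 e1Y.
have Wc : W c' by exact: path_const_qiso.
have fE0 : f = e0 \oc w'.
  apply: under_hom_eq; apply: pushout_hom_eq.
    apply: etrans f0X _; apply: etrans (esym e0Y) _.
    by rewrite -[under_map YT]wX; exact: dgHom_eq.
  apply: dgHom_eq => n a; rewrite -[RHS]/(ev0 _ (dg_comp w x n a)).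
  have -> : dg_comp w x = l by exact: wC.
  exact: (congr1 (fun h : dgHom C (prod_alg _ _) => (h n a).1) (esym ev)).
have fE1 : f' = e1 \oc w'.
  apply: under_hom_eq; apply: pushout_hom_eq.
    apply: etrans f1X _; apply: etrans (esym e1Y) _.
    by rewrite -[under_map YT]wX; exact: dgHom_eq.
  apply: dgHom_eq => n a; rewrite -[RHS]/(ev1 _ (dg_comp w x n a)).
  have -> : dg_comp w x = l by exact: wC.
  exact: (congr1 (fun h : dgHom C (prod_alg _ _) => (h n a).2) (esym ev)).
have ec0 : e0 \oc c' = idc Y by apply: under_hom_eq; exact: dgHom_eq.
have ec1 : e1 \oc c' = idc Y by apply: under_hom_eq; exact: dgHom_eq.
have evE (e : @Defs.hom UP YT Y) : e \oc c' = idc Y ->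
    zz_eq (zz_fwd (e \oc w') (zz_nil W Y)) (zz_fwd w' (zz_bwd Wc (zz_nil W Y))).
  move=> ec; apply: zz_trans (zz_sym (zz_comp _ _ _)) _; apply: zz_congr_fwd.
  apply: zz_trans (zz_sym (zz_bwd_fwd Wc _)) _; apply: zz_congr_bwd.
  apply: zz_trans (zz_comp _ _ _) _; rewrite ec; exact: zz_id.
by rewrite fE0 fE1; exact: zz_trans (evE e0 ec0) (zz_sym (evE e1 ec1)).
Qed.

Lemma unitary_fwd (Z Y : UP) (f : @Defs.hom UP Z Y) : unitary Z -> unitary Y.
Proof.
move=> uZ g; pose f0 : dgHom (under_tgt Z) (under_tgt Y) := sval f.
have fZ : dg_comp f0 (under_map Z) = under_map Y by exact: (svalP f).
rewrite -fZ; exact: (hunit_hom f0 (uZ g)).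
Qed.

Lemma unitary_bwd (Z Y : UP) (f : @Defs.hom UP Z Y) :
  W f -> unitary Y -> unitary Z.
Proof.
move=> Wf uY g; pose f0 : dgHom (under_tgt Z) (under_tgt Y) := sval f.
have fZ : dg_comp f0 (under_map Z) = under_map Y by exact: (svalP f).
apply: (@hunit_reflect k _ _ f0) => //.
  by apply: (is_cycle_hom (under_map Z)); exact: is_cycle_hom.
by have := uY g; rewrite -fZ.
Qed.

(** A backward quasi-isomorphism [w : Z' -> Z] is passed by choosing any map
    [X -> Z'], as its composite with [w] equals [a] after localisation. *)
Lemma zigzag_strict (Z Y : UP) (p : zigzag W Z Y) (a : @Defs.hom UP X Z) :
  exists b : @Defs.hom UP X Y, zz_eq (zz_fwd a p) (zz_fwd b (zz_nil W Y)).
Proof.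
elim: p a => {Z Y} [Z|Z Z' Y f p IH|Z Z' Y w Ww p IH] a.
- by exists a; exact: zz_refl.
- have [b eb] := IH (f \oc a); exists b.
  exact: zz_trans (zz_comp _ _ _) eb.
- have uZ : unitary Z by apply: (unitary_fwd a); exact: pushout_unitary.
  have [a' _] := strict_map_exists (unitary_bwd Ww uZ).
  have [b eb] := IH a'; exists b; apply: zz_trans eb.
  have := zz_cat_congl (zz_bwd Ww p) (strict_map_uniq a (w \oc a') uZ) => /= e.
  apply: (zz_trans e); apply: zz_trans (zz_sym (zz_comp _ _ _)) _.
  by apply: zz_congr_fwd; exact: zz_fwd_bwd.
Qed.

Lemma unitary_initial (Y : UP) : unitary Y ->
  exists! f : @Defs.hom (localisation W) X Y, True.
Proof.
move=> uY; have [f _] := strict_map_exists uY.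
exists (strict_map f); split=> // f' _.
have [p ->] := loc_class_surj f'; apply/loc_classP.
have [b eb] := zigzag_strict p (idc X).
apply: zz_trans (strict_map_uniq f b uY) _.
exact: zz_trans (zz_sym eb) (zz_id p).
Qed.
End Assembly.

Theorem theorem3p10 (k : comPzRingType) (A : dgAlg k) (S : hset A)
    (rep : forall g : hset_gen S, cycles A (hset_deg g))
    (rep_class : forall g : hset_gen S, hclass (rep g) = sval (tagged g))
    (P : @cof_repl k A) (X : derived_under P) :
  is_derived_free_product (free_lift rep)
    (free_to_inv k (@hset_deg k A S)) X ->
  is_derived_localisation S X.
Proof.
move=> [Q [i [C [j [r [x [[_ sq] j_cof r_qiso rj po]]]]]]].
pose deg := @hset_deg k A S.
pose q : dgHom (repl_ob Q) (free_alg k deg) := repl_map Q.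
pose i0 : dgHom (repl_ob Q) (repl_ob P) := i.
have hiota (g : hset_gen S) : exists z : gr (repl_ob Q) (deg g),
    is_cycle z /\ q _ z = pgen (@no_rel k _ deg) g.
  have [_ surj] := proj1 (quasi_isoP q) (repl_quasi_iso Q).
  have [z hz [b qz]] := surj _ _ (is_cycle_pres (pgen (@no_rel k _ deg) g)).
  by exists z; split=> //; apply/eqP; rewrite -subr_eq0 qz.
pose iota g := sval (cid (hiota g)).
have iota_cycle g : is_cycle (iota g) by rewrite /iota; case: cid => z [].
have q_iota g : q _ (iota g) = pgen (@no_rel k _ deg) g.
  by rewrite /iota; case: cid => z [].
have j_unit := j_iota_unit r_qiso rj iota_cycle q_iota.
have lift := localising_lifting (@repl_cofibrant k (free_alg k deg) Q)
    (repl_quasi_iso Q) j_cof r_qiso rj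
  iota_cycle q_iota.
(* The square over [A] commutes, so [iota g] represents the class [g] in [P]. *)
have p_iota g (hc : is_cycle (i0 _ (iota g))) :
  hmap (repl_map P) (hclass (Cycles hc)) = sval (tagged g).
  rewrite -rep_class hmapE; congr hclass; apply: val_inj => /=.
  have sq' : dg_comp (repl_map P) i0 = dg_comp (free_lift rep) q by exact: sq.
  rewrite -[LHS]/(dg_comp (repl_map P) i0 _ (iota g)) sq'.
  rewrite -[LHS]/(free_lift rep _ (q _ (iota g))) q_iota.
  exact: (@pres_liftE k _ deg (@no_rel k _ deg) A).
have i_cycle g : is_cycle (i0 _ (iota g)) by exact: is_cycle_hom.
have unitaryP (Y : under (repl_ob P)) :
    @inverting k A S P Y <-> unitary (deg := deg) i0 iota Y.
  pose y : dgHom (repl_ob P) (under_tgt Y) := under_map Y.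
  split=> [inv g|uY n s Ss z zs].
    have := inv _ _ (svalP (tagged g)) _ (p_iota g (i_cycle g)).
    by rewrite hmapE => /hinvertibleP.
  pose g : hset_gen S := existT _ n (exist _ s Ss).
  have -> : z = hclass (Cycles (i_cycle g)).
    by apply: (bij_inj (repl_quasi_iso P n)); rewrite zs; apply: esym;
      exact: (p_iota g (i_cycle g)).
  by rewrite hmapE; apply/hinvertibleP; exact: (uY g).
split; first by apply/unitaryP; exact: (pushout_unitary j_unit po).
move=> Y /unitaryP uY; exact: (unitary_initial iota_cycle lift j_unit po uY).
Qed.
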